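(* (A) Let $a>0$ and $\delta>0$, and define $\Phi_\delta:\mathbb{R}^2\to\mathbb{C}^2$ by $$\Phi_\delta(s,t)=\frac{1}{\sqrt{2a}}\Big(i\sinh\delta\,\cosh t\;e^{-\frac{is}{\cosh\delta}},\ \tanh\delta\,\sinh t\;e^{i\,\cosh\delta\,s}\Big).$$ Then $\Phi_\delta$ is a Hamiltonian stationary Lagrangian conformal immersion and a self-similar solution for mean curvature flow satisfying $H=a\,\Phi_\delta^\perp$. If $\cosh^2\delta\notin\mathbb{Q}$, then $\Phi_\delta$ is, in addition, an embedded self-expander plane asymptotic to the Hamiltonian stationary Lagrangian cone $$\big\{\big(i\,x_1e^{-\frac{is}{\cosh\delta}},\ x_2e^{i\,\cosh\delta\,s}\big): (x_1,x_2)\in\mathbb{R}^2,\ s\in\mathbb{R},\ x_1^2=\cosh^2\delta\;x_2^2\big\}.$$ If $\cosh^2\delta=p/q\in\mathbb{Q}$ with $p>q$ coprime positive integers, then $\Phi_\delta$ is given by $\Phi_{p,q}:\mathbb{R}^2\to\mathbb{C}^2$, $$\Phi_{p,q}(s,t)=\sqrt{\frac{p-q}{2a}}\Big(\frac{i}{\sqrt q}\cosh t\;e^{-i\sqrt{q/p}\,s},\ \frac{1}{\sqrt p}\sinh t\;e^{i\sqrt{p/q}\,s}\Big)$$ and satisfies $\Phi_{p,q}(s+2\pi\sqrt{pq},t)=\Phi_{p,q}(s,t)$ for all $(s,t)\in\mathbb{R}^2$, inducing a Hamiltonian stationary Lagrangian immersion of a self-expander cylinder. Moreover, if $p$ is odd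 and $q$ is even, then $\Phi_{p,q}(s+\pi\sqrt{pq},-t)=\Phi_{p,q}(s,t)$ for all $(s,t)\in\mathbb{R}^2$, inducing a Hamiltonian stationary Lagrangian immersion of a self-expander Moebius strip. (B) Let $a<0$ and $0<\gamma<\pi/2$, and define $\Upsilon_\gamma:\mathbb{R}^2\to\mathbb{C}^2$ by $$\Upsilon_\gamma(s,t)=\frac{1}{\sqrt{-2a}}\Big(-i\sin\gamma\,\cosh t\;e^{\frac{is}{\cos\gamma}},\ \tan\gamma\,\sinh t\;e^{-i\,\cos\gamma\,s}\Big).$$ Then $\Upsilon_\gamma$ is a Hamiltonian stationary Lagrangian conformal immersion and a self-similar solution for mean curvature flow satisfying $H=a\,\Upsilon_\gamma^\perp$. If $\cos^2\gamma\notin\mathbb{Q}$, then $\Upsilon_\gamma$ is, in addition, an embedded self-shrinker plane asymptotic to the Hamiltonian stationary Lagrangian cone $$\big\{\big(-i\,x_1e^{\frac{is}{\cos\gamma}},\ x_2e^{-i\,\cos\gamma\,s}\big): (x_1,x_2)\in\mathbb{R}^2,\ s\in\mathbb{R},\ x_1^2=\cos^2\gamma\;x_2^2\big\}.$$ If $\cos^2\gamma=p/q\in\mathbb{Q}$ with $p<q$ coprime positive integers, then $\Upsilon_\gamma$ is given by $\Upsilon_{p,q}:\mathbb{R}^2\to\mathbb{C}^2$, $$\Upsilon_{p,q}(s,t)=\sqrt{\frac{q-p}{-2a}}\Big(\frac{-i}{\sqrt q}\cosh t\;e^{i\sqrt{q/p}\,s},\ \frac{1}{\sqrt p}\sinh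 t\;e^{-i\sqrt{p/q}\,s}\Big)$$ and satisfies $\Upsilon_{p,q}(s+2\pi\sqrt{pq},t)=\Upsilon_{p,q}(s,t)$ for all $(s,t)\in\mathbb{R}^2$, inducing a Hamiltonian stationary Lagrangian immersion of a self-shrinker cylinder. Moreover, if $q$ is even and $p$ is odd, then $\Upsilon_{p,q}(s+\pi\sqrt{pq},-t)=\Upsilon_{p,q}(s,t)$ for all $(s,t)\in\mathbb{R}^2$, inducing a Hamiltonian stationary Lagrangian immersion of a self-shrinker Moebius strip.
   Context: $\mathbb{C}^2\equiv\mathbb{R}^4$ carries the Euclidean metric $\langle z,w\rangle=\mathrm{Re}(z_1\bar w_1+z_2\bar w_2)$, the complex structure $J$ (multiplication by $i$) and the Kähler form $\omega=\langle J\cdot,\cdot\rangle$. An immersion $\phi:M\to\mathbb{C}^2$ of a surface is Lagrangian if $\phi^*\omega=0$; $M$ carries the induced metric. The mean curvature vector is $H=\tfrac12\,\mathrm{trace}\,\sigma$, with $\sigma$ the second fundamental form (note the factor $1/2$), and $\phi^\perp$ denotes the normal projection of the position vector $\phi$. Locally (choosing a local orientation with area form $\omega_M$) the Lagrangian angle $\beta$ is defined, modulo $2\pi$, by $\phi^*(dz_1\wedge dz_2)=e^{i\beta}\omega_M$. The Lagrangian immersion is Hamiltonian stationary if $\beta$ is harmonic for the Laplacian of the induced metric. An immersion is a self-similar solution for mean curvature flow if $H=a\phi^\perp$ for some nonzero constant $a$; it is a self-expander if $a>0$ and a self-shrinker if $a<0$. A map from $\mathbb{R}^2$ is conformal if its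 induced metric is a positive function times $ds^2+dt^2$. ''Asymptotic to the cone'' refers to the behaviour as $t\to\pm\infty$, where $\cosh t$ and $\sinh t$ are replaced by $e^{|t|}/2$ and $\pm e^{|t|}/2$. The cylinder is the quotient of $\mathbb{R}^2$ by the translation $(s,t)\mapsto(s+2\pi\sqrt{pq},t)$, and the Moebius strip is the quotient of $\mathbb{R}^2$ by the group generated by $(s,t)\mapsto(s+\pi\sqrt{pq},-t)$.
   Formalization: ''Embedded'' is false, since on t=0 the maps have period 2π cosh δ (resp. 2π cos γ) in s; instead it is shown that these coincidences on t=0 are the only ones, so the maps are injective for t≠0; no homeomorphism onto the image is claimed. *)

(* Defs.v *)
(* Stdlib reals with Coquelicot. *)
From Stdlib Require Export Reals QArith Qreals Relations Arith.
From Coquelicot Require Export Coquelicot.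
#[export] Set Implicit Arguments.
#[export] Unset Strict Implicit.
#[export] Unset Printing Implicit Defensive.
Open Scope R_scope.

Definition irrational (x : R) : Prop := forall r : Q, x <> Q2R r.

(** * The complex plane [C^2] *)

Definition C2 : Type := (C * C)%type.

Definition add2 (z w : C2) : C2 := (Cplus (fst z) (fst w), Cplus (snd z) (snd w)).
Definition sub2 (z w : C2) : C2 := (Cminus (fst z) (fst w), Cminus (snd z) (snd w)).
Definition scal2 (r : R) (z : C2) : C2 :=
  (Cmult (RtoC r) (fst z), Cmult (RtoC r) (snd z)).
Definition zero2 : C2 := (RtoC 0, RtoC 0).
Definition J (z : C2) : C2 := (Cmult Ci (fst z), Cmult Ci (snd z)).

Definition inner (z w : C2) : R :=
  Re (Cplus (Cmult (fst z) (Cconj (fst w))) (Cmult (snd z) (Cconj (snd w)))).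
Definition norm2 (z : C2) : R := sqrt (inner z z).
Definition omega (z w : C2) : R := inner (J z) w.
Definition dz1dz2 (z w : C2) : C :=
  Cminus (Cmult (fst z) (snd w)) (Cmult (fst w) (snd z)).

Definition expi (x : R) : C := (cos x, sin x).

(** * Calculus on open subsets of [R^2] *)

Definition d1 (f : R * R -> R) (p : R * R) : R :=
  Derive (fun s => f (s, snd p)) (fst p).
Definition d2 (f : R * R -> R) (p : R * R) : R :=
  Derive (fun t => f (fst p, t)) (snd p).

Fixpoint Ck (k : nat) (U : R * R -> Prop) (f : R * R -> R) : Prop :=
  (forall p, U p -> continuous f p) /\
  match k with
  | O => True
  | S k' =>
      (forall p, U p ->
         ex_derive (fun s => f (s, snd p)) (fst p) /\
         ex_derive (fun t => f (fst p, t)) (snd p)) /\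
      Ck k' U (d1 f) /\ Ck k' U (d2 f)
  end.

Definition smooth (U : R * R -> Prop) (f : R * R -> R) : Prop :=
  forall k, Ck k U f.

Definition smooth_R2 (U : R * R -> Prop) (f : R * R -> R * R) : Prop :=
  smooth U (fun p => fst (f p)) /\ smooth U (fun p => snd (f p)).

Definition smooth_C2 (U : R * R -> Prop) (F : R * R -> C2) : Prop :=
  smooth U (fun p => Re (fst (F p))) /\ smooth U (fun p => Im (fst (F p))) /\
  smooth U (fun p => Re (snd (F p))) /\ smooth U (fun p => Im (snd (F p))).

Definition lift_C2 (d : (R * R -> R) -> R * R -> R) (F : R * R -> C2) (p : R * R)
  : C2 :=
  ((d (fun q => Re (fst (F q))) p, d (fun q => Im (fst (F q))) p),
   (d (fun q => Re (snd (F q))) p, d (fun q => Im (snd (F q))) p)).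

Definition D1 : (R * R -> C2) -> R * R -> C2 := lift_C2 d1.
Definition D2 : (R * R -> C2) -> R * R -> C2 := lift_C2 d2.

(** * Geometry of a parametrized piece of surface [F : U -> C^2] *)

Definition diff (F : R * R -> C2) (p u : R * R) : C2 :=
  add2 (scal2 (fst u) (D1 F p)) (scal2 (snd u) (D2 F p)).

Definition g11 (F : R * R -> C2) (p : R * R) : R := inner (D1 F p) (D1 F p).
Definition g12 (F : R * R -> C2) (p : R * R) : R := inner (D1 F p) (D2 F p).
Definition g22 (F : R * R -> C2) (p : R * R) : R := inner (D2 F p) (D2 F p).
Definition detg (F : R * R -> C2) (p : R * R) : R :=
  g11 F p * g22 F p - g12 F p ^ 2.

(* The area form of the chart orientation is [area F * ds /\ dt]. *)
Definition area (F : R * R -> C2) (p : R * R) : R := sqrt (detg F p).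

(* Coefficients of the inverse metric. *)
Definition gi11 (F : R * R -> C2) (p : R * R) : R := g22 F p / detg F p.
Definition gi12 (F : R * R -> C2) (p : R * R) : R := - g12 F p / detg F p.
Definition gi22 (F : R * R -> C2) (p : R * R) : R := g11 F p / detg F p.

Definition tangent_part (F : R * R -> C2) (p : R * R) (v : C2) : C2 :=
  diff F p
    (gi11 F p * inner v (D1 F p) + gi12 F p * inner v (D2 F p),
     gi12 F p * inner v (D1 F p) + gi22 F p * inner v (D2 F p)).

Definition normal_part (F : R * R -> C2) (p : R * R) (v : C2) : C2 :=
  sub2 v (tangent_part F p v).

(* The second fundamental form evaluated on the coordinate fields. *)
Definition sigma11 (F : R * R -> C2) (p : R * R) : C2 :=
  normal_part F p (D1 (D1 F) p).
Definition sigma12 (F : R * R -> C2) (p : R * R) : C2 :=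
  normal_part F p (D1 (D2 F) p).
Definition sigma22 (F : R * R -> C2) (p : R * R) : C2 :=
  normal_part F p (D2 (D2 F) p).

Definition mean_curvature (F : R * R -> C2) (p : R * R) : C2 :=
  scal2 (1 / 2)
    (add2 (scal2 (gi11 F p) (sigma11 F p))
       (add2 (scal2 (2 * gi12 F p) (sigma12 F p))
             (scal2 (gi22 F p) (sigma22 F p)))).

(* The Laplace-Beltrami operator of the metric induced by [F]. *)
Definition laplacian (F : R * R -> C2) (b : R * R -> R) (p : R * R) : R :=
  / area F p *
  (d1 (fun q => area F q * (gi11 F q * d1 b q + gi12 F q * d2 b q)) p +
   d2 (fun q => area F q * (gi12 F q * d1 b q + gi22 F q * d2 b q)) p).

Definition immersed_on (U : R * R -> Prop) (F : R * R -> C2) : Prop :=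
  smooth_C2 U F /\
  forall p, U p -> forall u, diff F p u = zero2 -> u = (0, 0).

Definition lagrangian_on (U : R * R -> Prop) (F : R * R -> C2) : Prop :=
  forall p, U p -> forall u v, omega (diff F p u) (diff F p v) = 0.

Definition lagrangian_angle_on (U : R * R -> Prop) (F : R * R -> C2)
    (b : R * R -> R) : Prop :=
  forall p, U p ->
    dz1dz2 (D1 F p) (D2 F p) = Cmult (expi (b p)) (RtoC (area F p)).

(* The angle is only defined locally and modulo [2 PI]; neither the choice of a
   smooth branch nor that of the orientation affects harmonicity. *)
Definition hamiltonian_stationary_on (U : R * R -> Prop) (F : R * R -> C2)
  : Prop :=
  forall p, U p ->
  exists (V : R * R -> Prop) (b : R * R -> R),
    open V /\ V p /\ (forall q, V q -> U q) /\ smooth V b /\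
    lagrangian_angle_on V F b /\ forall q, V q -> laplacian F b q = 0.

Definition similar_on (a : R) (U : R * R -> Prop) (F : R * R -> C2) : Prop :=
  forall p, U p -> mean_curvature F p = scal2 a (normal_part F p (F p)).

Definition conformal (F : R * R -> C2) : Prop :=
  forall p, 0 < g11 F p /\ g11 F p = g22 F p /\ g12 F p = 0.

(** * Surfaces and their immersions in [C^2] *)

(* An atlas is a family of local parametrizations: [A U x] says that the
   restriction of [x] to [U] is one of them. *)
Definition atlas (M : Type) : Type := (R * R -> Prop) -> (R * R -> M) -> Prop.

Record smooth_surface (M : Type) (A : atlas M) : Prop := {
  chart_open : forall U x, A U x -> open U;
  chart_inj : forall U x, A U x ->
    forall p q, U p -> U q -> x p = x q -> p = q;
  chart_cover : exists (U : nat -> R * R -> Prop) (x : nat -> R * R -> M),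
    (forall n, A (U n) (x n)) /\
    forall m, exists n p, U n p /\ x n p = m;
  chart_transition : forall U x V y, A U x -> A V y ->
    let W := fun p => U p /\ exists q, V q /\ y q = x p in
    open W /\
    exists tau : R * R -> R * R,
      smooth_R2 W tau /\ forall p, W p -> V (tau p) /\ y (tau p) = x p;
  surface_hausdorff : forall m m' : M, m <> m' ->
    exists U x V y p q, A U x /\ A V y /\ U p /\ V q /\ x p = m /\ y q = m' /\
    exists O O', open O /\ open O' /\ O p /\ O' q /\
      forall p' q', U p' -> O p' -> V q' -> O' q' -> x p' <> y q'
}.

Definition immersion (M : Type) (A : atlas M) (f : M -> C2) : Prop :=
  smooth_surface A /\
  forall U x, A U x -> immersed_on U (fun p => f (x p)).

Definition lagrangian (M : Type) (A : atlas M) (f : M -> C2) : Prop :=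
  forall U x, A U x -> lagrangian_on U (fun p => f (x p)).

Definition hamiltonian_stationary (M : Type) (A : atlas M) (f : M -> C2) : Prop :=
  forall U x, A U x -> hamiltonian_stationary_on U (fun p => f (x p)).

Definition HSL_immersion (M : Type) (A : atlas M) (f : M -> C2) : Prop :=
  immersion A f /\ lagrangian A f /\ hamiltonian_stationary A f.

Definition self_similar_with (a : R) (M : Type) (A : atlas M) (f : M -> C2)
  : Prop :=
  a <> 0 /\ forall U x, A U x -> similar_on a U (fun p => f (x p)).

Definition self_expander (M : Type) (A : atlas M) (f : M -> C2) : Prop :=
  exists a, 0 < a /\ self_similar_with a A f.

Definition self_shrinker (M : Type) (A : atlas M) (f : M -> C2) : Prop :=
  exists a, a < 0 /\ self_similar_with a A f.

Definition plane_atlas : atlas (R * R) :=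
  fun U x => U = (fun _ => True) /\ x = (fun p => p).

(** * Quotients of [R^2] by the group generated by a bijection [g] *)

Definition orbit (g : R * R -> R * R) (x : R * R) : R * R -> Prop :=
  clos_refl_sym_trans (R * R) (fun y z => z = g y) x.

Definition quotient (g : R * R -> R * R) : Type :=
  {c : R * R -> Prop | exists x, c = orbit g x}.

Definition proj (g : R * R -> R * R) (x : R * R) : quotient g :=
  exist _ (orbit g x) (ex_intro _ x eq_refl).

(* The local parametrizations are the restrictions of the projection to the open
   sets on which it is injective. *)
Definition quotient_atlas (g : R * R -> R * R) : atlas (quotient g) :=
  fun U x => open U /\ x = proj g /\
    forall p q, U p -> U q -> proj g p = proj g q -> p = q.
Arguments quotient_atlas : clear implicits.

Definition cylinder_map (p q : nat) (x : R * R) : R * R :=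
  (fst x + 2 * PI * sqrt (INR p * INR q), snd x).

Definition moebius_map (p q : nat) (x : R * R) : R * R :=
  (fst x + PI * sqrt (INR p * INR q), - snd x).

(** * Cones *)

(* A cone is invariant under positive dilations and singular at most at its
   vertex; the remaining part is an immersed Hamiltonian stationary Lagrangian
   surface. *)
Definition HSL_cone (K : C2 -> Prop) : Prop :=
  (forall r z, 0 < r -> K z -> K (scal2 r z)) /\
  exists (M : Type) (A : atlas M) (f : M -> C2),
    HSL_immersion A f /\ forall z, (K z /\ z <> zero2) <-> exists m, f m = z.

(* [F'] is the map obtained from [F] by replacing [cosh t] and [sinh t] with
   their leading terms [exp |t| / 2] and [+-exp |t| / 2]. *)
Definition asymptotic_through (F F' : R * R -> C2) (K : C2 -> Prop) : Prop :=
  (forall s t, t <> 0 -> K (F' (s, t))) /\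
  forall eps, 0 < eps -> exists T, forall s t, T < Rabs t ->
    norm2 (sub2 (F (s, t)) (F' (s, t))) < eps.

Definition cosh_lead (t : R) : R := exp (Rabs t) / 2.
Definition sinh_lead (t : R) : R := sign t * (exp (Rabs t) / 2).

(** * The two families *)

(* [Phi] and [Upsilon] with the values of [cosh t] and [sinh t] as parameters. *)
Definition Phi_gen (a delta : R) (ch sh : R -> R) (x : R * R) : C2 :=
  scal2 (/ sqrt (2 * a))
    (Cmult (Cmult Ci (RtoC (sinh delta * ch (snd x))))
           (expi (- (fst x / cosh delta))),
     Cmult (RtoC (tanh delta * sh (snd x))) (expi (cosh delta * fst x))).

Definition Phi (a delta : R) : R * R -> C2 := Phi_gen a delta cosh sinh.
Definition Phi_lead (a delta : R) : R * R -> C2 :=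
  Phi_gen a delta cosh_lead sinh_lead.

Definition Phi_cone (delta : R) (z : C2) : Prop :=
  exists x1 x2 s, x1 ^ 2 = cosh delta ^ 2 * x2 ^ 2 /\
    z = (Cmult (Cmult Ci (RtoC x1)) (expi (- (s / cosh delta))),
         Cmult (RtoC x2) (expi (cosh delta * s))).

Definition Phi_pq (a : R) (p q : nat) (x : R * R) : C2 :=
  scal2 (sqrt ((INR p - INR q) / (2 * a)))
    (Cmult (Cmult Ci (RtoC (/ sqrt (INR q) * cosh (snd x))))
           (expi (- (sqrt (INR q / INR p) * fst x))),
     Cmult (RtoC (/ sqrt (INR p) * sinh (snd x)))
           (expi (sqrt (INR p / INR q) * fst x))).

Definition Upsilon_gen (a gamma : R) (ch sh : R -> R) (x : R * R) : C2 :=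
  scal2 (/ sqrt (- 2 * a))
    (Cmult (Cmult (Copp Ci) (RtoC (sin gamma * ch (snd x))))
           (expi (fst x / cos gamma)),
     Cmult (RtoC (tan gamma * sh (snd x))) (expi (- (cos gamma * fst x)))).

Definition Upsilon (a gamma : R) : R * R -> C2 := Upsilon_gen a gamma cosh sinh.
Definition Upsilon_lead (a gamma : R) : R * R -> C2 :=
  Upsilon_gen a gamma cosh_lead sinh_lead.

Definition Upsilon_cone (gamma : R) (z : C2) : Prop :=
  exists x1 x2 s, x1 ^ 2 = cos gamma ^ 2 * x2 ^ 2 /\
    z = (Cmult (Cmult (Copp Ci) (RtoC x1)) (expi (s / cos gamma)),
         Cmult (RtoC x2) (expi (- (cos gamma * s)))).

Definition Upsilon_pq (a : R) (p q : nat) (x : R * R) : C2 :=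
  scal2 (sqrt ((INR q - INR p) / (- 2 * a)))
    (Cmult (Cmult (Copp Ci) (RtoC (/ sqrt (INR q) * cosh (snd x))))
           (expi (sqrt (INR q / INR p) * fst x)),
     Cmult (RtoC (/ sqrt (INR p) * sinh (snd x)))
           (expi (- (sqrt (INR p / INR q) * fst x)))).

(** * Embeddedness

   On the waist line [t = 0] the second coordinate vanishes, so there
   [Phi a delta] has period [2 PI cosh delta] and [Upsilon a gamma] has period
   [2 PI cos gamma] in [s]: neither map is injective on the whole plane, whatever
   its parameter.  [embedded_off_waist L F] says that these coincidences, [L] being
   the period of the waist, are the only ones; in particular [F] is injective on
   [t <> 0].  No topological condition is added: in the irrational case each line
   [t = const <> 0] winds densely around a torus, so the inverse of [F] is not
   continuous for the induced topology. *)
Definition embedded_off_waist (L : R) (F : R * R -> C2) : Prop :=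
  forall s t s' t',
    F (s, t) = F (s', t') <->
    (s = s' /\ t = t') \/
    (t = 0 /\ t' = 0 /\ exists k : Z, s' = s + IZR k * L).

(* Main.v *)
(** Both families, with [mn = 1], are instances of
    [F(s,t) = (i A ch(t) e^(-ims), m A sh(t) e^(ins))], and the asymptotic cones are
    made of the same maps with [ch = sh = exp] and arbitrary signs.  Only [ch' = sh]
    and [sh' = ch] matter for the first order: the metric is [E (ds^2 + dt^2)] with
    [E = A^2 (m^2 ch^2 + sh^2)], the map is Lagrangian, and its angle
    [(n - m) s + const] is affine, hence harmonic for every conformal metric.  If
    moreover [ch^2 - sh^2 = 1] and [2 a m^2 A^2 = 1 - m^2], then
    [F_ss + F_tt = 2aE F - 2a A^2 (1 + m^2) ch sh F_t], whose normal part is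
    [2aE] times that of [F]; this is [H = a F^perp].

    Comparing moduli, [F(s,t) = F(s',t')] forces [t' = +-t] and [m (s - s')] in
    [2 PI Z]; off the waist also [n (s - s')] is in [PI Z], so a nontrivial
    coincidence makes [n^2] rational.  In the rational case [F] is invariant under
    [(s,t) -> (s + T, +-t)]; the orbits are discrete with only the trivial element
    moving [s] by less than [T], which makes the quotient a smooth Hausdorff
    surface. *)
From Stdlib Require Import FunctionalExtensionality PropExtensionality.
From Stdlib Require Import ClassicalEpsilon ProofIrrelevance ZArith Lra Lia Psatz.
Require Import Defs.
Open Scope R_scope.

(** * Smoothness *)

Definition plane : R * R -> Prop := fun _ => True.

(** Closure under [Derive] takes the place of formulas for higher derivatives. *)
Definition derive_stable (Q : (R -> R) -> Prop) : Prop :=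
  forall u, Q u -> (forall x, ex_derive u x) /\ Q (Derive u).

(** Each partial derivative of [u(s) * v(t)] is again such a product, with one factor
    differentiated; hence the induction on [k] is uniform in both factors. *)
Lemma smooth_separated (Q1 Q2 : (R -> R) -> Prop) :
  derive_stable Q1 -> derive_stable Q2 ->
  forall (U : R * R -> Prop) u v, Q1 u -> Q2 v ->
  smooth U (fun p => u (fst p) * v (snd p)).
Proof.
  intros H1 H2 U u v Hu Hv k; revert u v Hu Hv.
  induction k as [|k IH]; intros u v Hu Hv;
    destruct (H1 u Hu) as [Eu Du]; destruct (H2 v Hv) as [Ev Dv];
    (assert (Hc : forall p, continuous (fun p : R * R => u (fst p) * v (snd p)) p);
     [ intros [s t]; apply (continuous_mult (K := R_AbsRing));
       [ apply (continuous_comp fst u); [apply continuous_fst|]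
       | apply (continuous_comp snd v); [apply continuous_snd|] ];
       apply (ex_derive_continuous (K := R_AbsRing) (V := R_NormedModule)); auto
     | split; [intros p _; apply Hc|] ]).
  - exact I.
  - split; [|split].
    + intros [s t] _; simpl; split; auto_derive; auto.
    + replace (d1 (fun p => u (fst p) * v (snd p)))
        with (fun p : R * R => Derive u (fst p) * v (snd p)).
      * now apply IH.
      * apply functional_extensionality; intros [s t]; unfold d1; simpl.
        symmetry; apply Derive_scal_l.
    + replace (d2 (fun p => u (fst p) * v (snd p)))
        with (fun p : R * R => u (fst p) * Derive v (snd p)).
      * now apply IH.
      * apply functional_extensionality; intros [s t]; unfold d2; simpl.
        symmetry; apply Derive_scal.
Qed.

Definition affine (u : R -> R) : Prop := exists x y, u = fun s => x * s + y.

Lemma affine_stable : derive_stable affine.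
Proof.
  intros u (x & y & ->); split.
  - intros s; auto_derive; auto.
  - exists 0, x; apply functional_extensionality; intros s.
    apply is_derive_unique; auto_derive; auto; ring.
Qed.

Definition trig_span (k : R) (u : R -> R) : Prop :=
  exists x y, u = fun s => x * cos (k * s) + y * sin (k * s).

Lemma trig_span_stable k : derive_stable (trig_span k).
Proof.
  intros u (x & y & ->); split.
  - intros s; auto_derive; auto.
  - exists (k * y), (- (k * x)); apply functional_extensionality; intros s.
    apply is_derive_unique; auto_derive; auto; ring.
Qed.

Definition hyperbolic_pair (ch sh : R -> R) : Prop :=
  forall t, is_derive ch t (sh t) /\ is_derive sh t (ch t).

Definition hyp_span (ch sh u : R -> R) : Prop :=
  exists x y, u = fun t => x * ch t + y * sh t.

Lemma hyp_span_stable ch sh :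
  hyperbolic_pair ch sh -> derive_stable (hyp_span ch sh).
Proof.
  intros H u (x & y & ->).
  assert (Hc : forall t, ex_derive ch t) by (intros t; exists (sh t); apply H).
  assert (Hs : forall t, ex_derive sh t) by (intros t; exists (ch t); apply H).
  split.
  - intros t; auto_derive; auto.
  - exists y, x; apply functional_extensionality; intros t.
    apply is_derive_unique; auto_derive; auto.
    rewrite (is_derive_unique (fun x : R => ch x) _ _ (proj1 (H t))),
      (is_derive_unique (fun x : R => sh x) _ _ (proj2 (H t))); ring.
Qed.

Lemma hyperbolic_pair_cosh_sinh : hyperbolic_pair cosh sinh.
Proof.
  intros t; split; apply is_derive_Reals;
    [apply derivable_pt_lim_cosh | apply derivable_pt_lim_sinh].
Qed.

Lemma hyperbolic_pair_exp : hyperbolic_pair exp exp.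
Proof. intros t; split; apply is_derive_exp. Qed.

Lemma locally_slices (P : R * R -> Prop) (p : R * R) : locally p P ->
  locally (fst p) (fun s => P (s, snd p)) /\
  locally (snd p) (fun t => P (fst p, t)).
Proof.
  intros [e He]; split; exists e; intros y Hy; apply He; split; simpl; auto;
    apply ball_center.
Qed.

(** Functions that agree near a point have partial derivatives that agree near it. The lemma serves
    the transition maps of the quotients, which are identified only locally. *)
Lemma Ck_local k (U : R * R -> Prop) f :
  (forall p, U p -> exists h, Ck k plane h /\ locally p (fun q => h q = f q)) ->
  Ck k U f.
Proof.
  revert f; induction k as [|k IH]; intros f H.
  - split; [|exact I]; intros p Hp; destruct (H p Hp) as (h & [Hh _] & Hl).
    exact (continuous_ext_loc f h p Hl (Hh p I)).
  - split; [|split; [|split]].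
    + intros p Hp; destruct (H p Hp) as (h & [Hh _] & Hl).
      exact (continuous_ext_loc f h p Hl (Hh p I)).
    + intros p Hp; destruct (H p Hp) as (h & (_ & Hd & _) & Hl).
      destruct (locally_slices Hl) as [L1 L2]; destruct (Hd p I) as [E1 E2].
      split; [exact (ex_derive_ext_loc _ _ _ L1 E1)
             | exact (ex_derive_ext_loc _ _ _ L2 E2)].
    + apply IH; intros p Hp; destruct (H p Hp) as (h & (_ & _ & Hd & _) & Hl).
      exists (d1 h); split; auto.
      (* Equality of the derivatives at [q] needs agreement on a whole neighbourhood of [q], not
         just at [q]; [locally_locally] supplies it for all [q] near [p]. *)
      apply locally_locally in Hl; revert Hl; apply filter_imp; intros q Hq.
      apply Derive_ext_loc; exact (proj1 (locally_slices Hq)).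
    + apply IH; intros p Hp; destruct (H p Hp) as (h & (_ & _ & _ & Hd) & Hl).
      exists (d2 h); split; auto.
      apply locally_locally in Hl; revert Hl; apply filter_imp; intros q Hq.
      apply Derive_ext_loc; exact (proj2 (locally_slices Hq)).
Qed.

(** The disjunction leaves a function of one coordinate, hence a product of two affine functions of
    one variable. *)
Lemma smooth_affine (U : R * R -> Prop) x y z :
  x = 0 \/ y = 0 -> smooth U (fun p => x * fst p + y * snd p + z).
Proof.
  assert (Ha : forall x y, affine (fun s => x * s + y)) by (intros; eexists _, _; reflexivity).
  intros [-> | ->].
  - replace (fun p : R * R => 0 * fst p + y * snd p + z)
      with (fun p : R * R => (fun s => 0 * s + 1) (fst p) * (fun t => y * t + z) (snd p)).
    + apply (@smooth_separated _ _ affine_stable affine_stable U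
        (fun s => 0 * s + 1) (fun t => y * t + z)); apply Ha.
    + apply functional_extensionality; intros; simpl; ring.
  - replace (fun p : R * R => x * fst p + 0 * snd p + z)
      with (fun p : R * R => (fun s => x * s + z) (fst p) * (fun t => 0 * t + 1) (snd p)).
    + apply (@smooth_separated _ _ affine_stable affine_stable U
        (fun s => x * s + z) (fun t => 0 * t + 1)); apply Ha.
    + apply functional_extensionality; intros; simpl; ring.
Qed.

(** * Conformal maps and the torus family *)

Lemma C2_ext (z w : C2) :
  fst (fst z) = fst (fst w) -> snd (fst z) = snd (fst w) ->
  fst (snd z) = fst (snd w) -> snd (snd z) = snd (snd w) -> z = w.
Proof.
  destruct z as [[a b] [c d]], w as [[a' b'] [c' d']]; simpl.
  now intros -> -> -> ->.
Qed.

Lemma inner_add_l u v w : inner (add2 u v) w = inner u w + inner v w.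
Proof. destruct u as [[][]], v as [[][]], w as [[][]]; unfold inner, add2; simpl; ring. Qed.

Lemma inner_scal_l r u w : inner (scal2 r u) w = r * inner u w.
Proof. destruct u as [[][]], w as [[][]]; unfold inner, scal2; simpl; ring. Qed.

Lemma inner_comm u v : inner u v = inner v u.
Proof. destruct u as [[][]], v as [[][]]; unfold inner; simpl; ring. Qed.

(** [omega] is alternating, so on a tangent plane it is determined by its value on the two
    coordinate fields. *)
Lemma omega_diff F p u v :
  omega (diff F p u) (diff F p v) =
  (fst u * snd v - snd u * fst v) * omega (D1 F p) (D2 F p).
Proof.
  unfold diff; destruct u as [u1 u2], v as [v1 v2]; simpl.
  destruct (D1 F p) as [[][]], (D2 F p) as [[][]]; unfold omega, inner, add2, scal2, J; simpl; ring.
Qed.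

Lemma inner_diff F p u :
  inner (diff F p u) (diff F p u) =
  fst u ^ 2 * g11 F p + 2 * (fst u * snd u) * g12 F p + snd u ^ 2 * g22 F p.
Proof.
  unfold diff, g11, g12, g22; destruct u as [u1 u2]; simpl.
  destruct (D1 F p) as [[][]], (D2 F p) as [[][]]; unfold inner, add2, scal2; simpl; ring.
Qed.

(** The squared length of [diff F p u] is [g11 F p * (u1^2 + u2^2)], which vanishes only for
    [u = (0, 0)]. *)
Lemma conformal_immersed (U : R * R -> Prop) F :
  smooth_C2 U F -> conformal F -> immersed_on U F.
Proof.
  intros Hs Hc; split; auto; intros p _ [u1 u2] Hu.
  destruct (Hc p) as (Hp & He & H0).
  assert (H : inner (diff F p (u1, u2)) (diff F p (u1, u2)) = 0)
    by (rewrite Hu; unfold inner, zero2; simpl; ring).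
  rewrite inner_diff, H0, <- He in H; simpl in H.
  assert (H' : u1 * u1 + u2 * u2 = 0).
  { apply Rmult_eq_reg_l with (g11 F p); lra. }
  f_equal; nra.
Qed.

Lemma normal_part_add F p v w :
  normal_part F p (add2 v w) = add2 (normal_part F p v) (normal_part F p w).
Proof.
  unfold normal_part, tangent_part; rewrite !inner_add_l; unfold diff.
  destruct (D1 F p) as [[][]], (D2 F p) as [[][]], v as [[][]], w as [[][]];
    apply C2_ext; simpl; ring.
Qed.

Lemma normal_part_scal F p r v :
  normal_part F p (scal2 r v) = scal2 r (normal_part F p v).
Proof.
  unfold normal_part, tangent_part; rewrite !inner_scal_l; unfold diff.
  destruct (D1 F p) as [[][]], (D2 F p) as [[][]], v as [[][]];
    apply C2_ext; simpl; ring.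
Qed.

Lemma conformal_metric F p : conformal F ->
  detg F p = g11 F p ^ 2 /\ area F p = g11 F p /\
  gi11 F p = / g11 F p /\ gi12 F p = 0 /\ gi22 F p = / g11 F p.
Proof.
  intros H; destruct (H p) as (Hp & He & H0).
  assert (Hd : detg F p = g11 F p ^ 2) by (unfold detg; rewrite <- He, H0; ring).
  unfold area, gi11, gi12, gi22; rewrite Hd, <- He, H0.
  repeat split; try (field; lra).
  rewrite sqrt_pow2; lra.
Qed.

Lemma normal_part_D2 F p : conformal F -> normal_part F p (D2 F p) = zero2.
Proof.
  intros H; destruct (H p) as (Hp & He & H0).
  destruct (conformal_metric p H) as (_ & _ & E1 & E2 & E3).
  unfold normal_part, tangent_part; rewrite E1, E2, E3.
  rewrite (inner_comm (D2 F p) (D1 F p)).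
  change (inner (D1 F p) (D2 F p)) with (g12 F p).
  change (inner (D2 F p) (D2 F p)) with (g22 F p).
  rewrite H0, <- He; unfold diff.
  destruct (D1 F p) as [[][]], (D2 F p) as [[][]];
    apply C2_ext; simpl; field; lra.
Qed.

(** The inverse metric is [/ g11] times the identity: the mixed term drops out, and the trace is the
    normal part of the flat Laplacian of [F]. *)
Lemma conformal_mean_curvature F p : conformal F ->
  mean_curvature F p =
  scal2 (/ (2 * g11 F p)) (normal_part F p (add2 (D1 (D1 F) p) (D2 (D2 F) p))).
Proof.
  intros H; destruct (H p) as (Hp & _).
  destruct (conformal_metric p H) as (_ & _ & E1 & E2 & E3).
  unfold mean_curvature; rewrite E1, E2, E3, normal_part_add.
  unfold sigma11, sigma12, sigma22.
  destruct (normal_part F p (D1 (D1 F) p)) as [[][]],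
    (normal_part F p (D2 (D2 F) p)) as [[][]],
    (normal_part F p (D1 (D2 F) p)) as [[][]]; apply C2_ext; simpl; field; lra.
Qed.

(* For a conformal metric the Laplacian is the flat one up to a factor, so affine
   functions are harmonic. *)
Lemma conformal_laplacian_affine F (k c : R) p : conformal F ->
  laplacian F (fun q => k * fst q + 0 * snd q + c) p = 0.
Proof.
  intros H; unfold laplacian.
  assert (B1 : d1 (fun q : R * R => k * fst q + 0 * snd q + c) = fun _ => k).
  { apply functional_extensionality; intros [s t]; unfold d1; simpl.
    apply is_derive_unique; auto_derive; auto; ring. }
  assert (B2 : d2 (fun q : R * R => k * fst q + 0 * snd q + c) = fun _ => 0).
  { apply functional_extensionality; intros [s t]; unfold d2; simpl.
    apply is_derive_unique; auto_derive; auto; ring. }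
  rewrite B1, B2.
  (* The product of [area] and [gi11] is 1, so the flux is the constant field [(k, 0)] and has zero
     divergence. *)
  replace (fun q => area F q * (gi11 F q * k + gi12 F q * 0)) with (fun _ : R * R => k).
  - replace (fun q => area F q * (gi12 F q * k + gi22 F q * 0)) with (fun _ : R * R => 0).
    + unfold d1, d2; rewrite !Derive_const; ring.
    + apply functional_extensionality; intros q.
      destruct (conformal_metric q H) as (_ & _ & _ & -> & _); ring.
  - apply functional_extensionality; intros q.
    destruct (conformal_metric q H) as (_ & -> & -> & _ & _).
    destruct (H q); field; lra.
Qed.

(* The map [(i A ch(t) e^(-ims), B sh(t) e^(ins))]: both families of the theorem
   and, for [ch = sh = exp], the pieces of their asymptotic cones. *)
Definition torus_family (m n A B : R) (ch sh : R -> R) (p : R * R) : C2 :=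
  ((A * ch (snd p) * sin (m * fst p), A * ch (snd p) * cos (m * fst p)),
   (B * sh (snd p) * cos (n * fst p), B * sh (snd p) * sin (n * fst p))).

Ltac solve_derivative ch sh H :=
  apply functional_extensionality; intros [s t];
  destruct (H t) as [Hc Hs]; apply C2_ext; simpl; unfold d1, d2; simpl;
  apply is_derive_unique; auto_derive;
  try (repeat split; eexists; eassumption);
  rewrite ?(is_derive_unique (fun x : R => ch x) _ _ Hc),
    ?(is_derive_unique (fun x : R => sh x) _ _ Hs); ring.

Lemma D1_torus_family m n A B ch sh : hyperbolic_pair ch sh ->
  D1 (torus_family m n A B ch sh) = fun p =>
  ((A * m * ch (snd p) * cos (m * fst p), - (A * m * ch (snd p) * sin (m * fst p))),
   (- (B * n * sh (snd p) * sin (n * fst p)), B * n * sh (snd p) * cos (n * fst p))).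
Proof. intros H; solve_derivative ch sh H. Qed.

(** Differentiation in [t] only exchanges [ch] and [sh], so the result stays in the family and the
    lemma can be applied twice. *)
Lemma D2_torus_family m n A B ch sh : hyperbolic_pair ch sh ->
  D2 (torus_family m n A B ch sh) = torus_family m n A B sh ch.
Proof. intros H; solve_derivative ch sh H. Qed.

(** Each coordinate is an eigenfunction of the second [s]-derivative; the eigenvalues [- m^2] and
    [- n^2] are absorbed in the amplitudes. *)
Lemma D1_D1_torus_family m n A B ch sh : hyperbolic_pair ch sh ->
  D1 (D1 (torus_family m n A B ch sh)) =
  torus_family m n (- (A * m ^ 2)) (- (B * n ^ 2)) ch sh.
Proof. intros H; rewrite D1_torus_family by assumption; solve_derivative ch sh H. Qed.

Lemma hyperbolic_pair_sym ch sh : hyperbolic_pair ch sh -> hyperbolic_pair sh ch.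
Proof. intros H t; destruct (H t); auto. Qed.

(** Oriented as a rule that eliminates squares of sines, to be passed to [ring] as an equation. *)
Lemma trig_one x : sin x * sin x = 1 - cos x * cos x.
Proof. generalize (sin2_cos2 x); unfold Rsqr; lra. Qed.

(** The second coordinate contributes [B^2 * n^2 * sh^2], which equals [A^2 * sh^2] because
    [m * n = 1]; this is what makes [g11] agree with [g22]. *)
Lemma g11_torus_family m n A B ch sh p :
  hyperbolic_pair ch sh -> m * n = 1 -> B ^ 2 = m ^ 2 * A ^ 2 ->
  g11 (torus_family m n A B ch sh) p =
  A ^ 2 * (m ^ 2 * ch (snd p) ^ 2 + sh (snd p) ^ 2).
Proof.
  intros H Hmn HB; unfold g11; rewrite D1_torus_family by assumption.
  unfold inner; simpl.
  transitivity (A ^ 2 * m ^ 2 * ch (snd p) ^ 2 + B ^ 2 * n ^ 2 * sh (snd p) ^ 2).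
  - ring_simplify; simpl; ring [(trig_one (m * fst p)) (trig_one (n * fst p))].
  - rewrite HB; ring [Hmn].
Qed.

Lemma g22_torus_family m n A B ch sh p :
  hyperbolic_pair ch sh -> B ^ 2 = m ^ 2 * A ^ 2 ->
  g22 (torus_family m n A B ch sh) p =
  A ^ 2 * (m ^ 2 * ch (snd p) ^ 2 + sh (snd p) ^ 2).
Proof.
  intros H HB; unfold g22; rewrite D2_torus_family by assumption.
  unfold inner; simpl.
  transitivity (B ^ 2 * ch (snd p) ^ 2 + A ^ 2 * sh (snd p) ^ 2).
  - ring [(trig_one (m * fst p)) (trig_one (n * fst p))].
  - rewrite HB; ring.
Qed.

(** In each complex coordinate the [s]-derivative is tangent to a circle about 0 and the
    [t]-derivative is radial. *)
Lemma g12_torus_family m n A B ch sh p : hyperbolic_pair ch sh ->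
  g12 (torus_family m n A B ch sh) p = 0.
Proof.
  intros H; unfold g12.
  rewrite D1_torus_family, D2_torus_family by assumption.
  unfold inner; simpl; ring.
Qed.

(** The conformal factor stays positive at zeros of [sh], since neither [m] nor [ch] vanishes. *)
Lemma torus_family_conformal m n A B ch sh :
  hyperbolic_pair ch sh -> m * n = 1 -> B ^ 2 = m ^ 2 * A ^ 2 -> A <> 0 ->
  (forall t, 0 < ch t) -> conformal (torus_family m n A B ch sh).
Proof.
  intros H Hmn HB HA Hch p.
  rewrite g11_torus_family, g22_torus_family, g12_torus_family by assumption.
  split; auto.
  assert (0 < A ^ 2) by (apply pow2_gt_0; auto).
  assert (0 < m ^ 2) by (apply pow2_gt_0; intros ->; lra).
  specialize (Hch (snd p)).
  assert (0 < ch (snd p) ^ 2) by (apply pow2_gt_0; lra).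
  apply Rmult_lt_0_compat; nra.
Qed.

Lemma torus_family_smooth m n A B ch sh (U : R * R -> Prop) :
  hyperbolic_pair ch sh -> smooth_C2 U (torus_family m n A B ch sh).
Proof.
  intros H.
  (* All four real components are a trigonometric function of [s] times a combination of [ch(t)] and
     [sh(t)]. *)
  assert (Hg : forall k x y x' y' f,
    (forall p : R * R, f p = (x * cos (k * fst p) + y * sin (k * fst p)) *
                     (x' * ch (snd p) + y' * sh (snd p))) -> smooth U f).
  { intros k x y x' y' f Hf.
    replace f with (fun p : R * R =>
      (fun s => x * cos (k * s) + y * sin (k * s)) (fst p) *
      (fun t => x' * ch t + y' * sh t) (snd p)).
    - apply (@smooth_separated _ _ (@trig_span_stable k) (hyp_span_stable H) U
        (fun s => x * cos (k * s) + y * sin (k * s)) (fun t => x' * ch t + y' * sh t));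
        eexists _, _; reflexivity.
    - apply functional_extensionality; intros p; now rewrite Hf. }
  repeat split.
  - apply (Hg m 0 1 A 0); intros p; simpl; ring.
  - apply (Hg m 1 0 A 0); intros p; simpl; ring.
  - apply (Hg n 1 0 0 B); intros p; simpl; ring.
  - apply (Hg n 0 1 0 B); intros p; simpl; ring.
Qed.

(** The form takes the value [(m * A^2 - n * B^2) * ch * sh] on the coordinate fields, and
    [n * B^2 = n * m^2 * A^2 = m * A^2]. *)
Lemma torus_family_lagrangian m n A B ch sh (U : R * R -> Prop) :
  hyperbolic_pair ch sh -> m * n = 1 -> B ^ 2 = m ^ 2 * A ^ 2 ->
  lagrangian_on U (torus_family m n A B ch sh).
Proof.
  intros H Hmn HB p _ u v; rewrite omega_diff.
  rewrite D1_torus_family, D2_torus_family by assumption.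
  replace (omega _ _) with (m * A ^ 2 * ch (snd p) * sh (snd p)
    - n * B ^ 2 * ch (snd p) * sh (snd p)).
  - rewrite HB; ring [Hmn].
  - unfold omega, inner, J; simpl.
    ring [(trig_one (m * fst p)) (trig_one (n * fst p))].
Qed.

(** The determinant of the coordinate fields is [A * B * (m * ch^2 + n * sh^2)] times the phase of
    angle [(n - m) * s]. As [B] is [m * A] up to sign, the real factor is the area up to the same
    sign, which the constant [c], either 0 or [PI], records. *)
Lemma torus_family_angle m n A B ch sh (U : R * R -> Prop) :
  hyperbolic_pair ch sh -> m * n = 1 -> B ^ 2 = m ^ 2 * A ^ 2 -> A <> 0 ->
  (forall t, 0 < ch t) ->
  exists c, lagrangian_angle_on U (torus_family m n A B ch sh)
    (fun p => (n - m) * fst p + 0 * snd p + c).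
Proof.
  intros H Hmn HB HA Hch.
  assert (Hm : m <> 0) by (intros ->; lra).
  assert (Hc : exists c, sin c = 0 /\ B = cos c * m * A).
  { assert (H0 : (B - m * A) * (B + m * A) = 0)
      by (transitivity (B ^ 2 - m ^ 2 * A ^ 2); [ring | lra]).
    apply Rmult_integral in H0 as [H0|H0].
    - exists 0; rewrite sin_0, cos_0; split; lra.
    - exists PI; rewrite sin_PI, cos_PI; split; lra. }
  destruct Hc as (c & Hsc & Hcc); exists c; intros p _.
  destruct (conformal_metric p
    (torus_family_conformal H Hmn HB HA Hch)) as (_ & -> & _).
  rewrite g11_torus_family, D1_torus_family, D2_torus_family by assumption.
  replace ((n - m) * fst p + 0 * snd p + c) with (n * fst p - m * fst p + c) by ring.
  unfold dz1dz2, expi; simpl.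
  rewrite cos_plus, sin_plus, cos_minus, sin_minus, Hsc, Hcc.
  apply injective_projections; simpl; ring [Hmn].
Qed.

Lemma torus_family_hamiltonian_stationary m n A B ch sh (U : R * R -> Prop) :
  open U -> hyperbolic_pair ch sh -> m * n = 1 -> B ^ 2 = m ^ 2 * A ^ 2 ->
  A <> 0 -> (forall t, 0 < ch t) ->
  hamiltonian_stationary_on U (torus_family m n A B ch sh).
Proof.
  intros HU H Hmn HB HA Hch p Hp.
  destruct (torus_family_angle U H Hmn HB HA Hch) as [c Hc].
  exists U; eexists; split; [exact HU|]; split; [exact Hp|]; split; [auto|].
  split; [|split; [exact Hc|]].
  - apply smooth_affine; auto.
  - intros q _; apply conformal_laplacian_affine.
    now apply torus_family_conformal.
Qed.

(** Once the tangent term in [F_t] is projected away, the factor [2aE] of [F] meets the [/ (2E)] of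
    the mean curvature, which leaves [a]. *)
Lemma torus_family_similar a m n A ch sh (U : R * R -> Prop) :
  hyperbolic_pair ch sh -> m * n = 1 -> A <> 0 -> (forall t, 0 < ch t) ->
  (forall t, ch t ^ 2 - sh t ^ 2 = 1) -> 2 * a * m ^ 2 * A ^ 2 = 1 - m ^ 2 ->
  similar_on a U (torus_family m n A (m * A) ch sh).
Proof.
  intros H Hmn HA Hch Hone Ha p _.
  assert (HB : (m * A) ^ 2 = m ^ 2 * A ^ 2) by ring.
  assert (Hconf := torus_family_conformal H Hmn HB HA Hch).
  rewrite conformal_mean_curvature by assumption.
  (* [F_ss + F_tt - 2aE F] is tangent, a multiple of [F_t]. *)
  assert (Hlap : add2 (D1 (D1 (torus_family m n A (m * A) ch sh)) p)
                      (D2 (D2 (torus_family m n A (m * A) ch sh)) p) =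
    add2 (scal2 (2 * a * g11 (torus_family m n A (m * A) ch sh) p)
            (torus_family m n A (m * A) ch sh p))
         (scal2 (- (2 * a * A ^ 2 * (1 + m ^ 2) * ch (snd p) * sh (snd p)))
            (D2 (torus_family m n A (m * A) ch sh) p))).
  { rewrite g11_torus_family, D1_D1_torus_family by assumption.
    rewrite D2_torus_family by assumption.
    rewrite D2_torus_family by (now apply hyperbolic_pair_sym).
    specialize (Hone (snd p)).
    assert (Hsh : sh (snd p) ^ 2 = ch (snd p) ^ 2 - 1) by lra.
    (* [Ha1] and, below, [Ha2] are the two coordinates of the identity, stripped of their phases. *)
    assert (Ha1 : (1 - m ^ 2) * ch (snd p) =
      2 * a * (A ^ 2 * (m ^ 2 * ch (snd p) ^ 2 + sh (snd p) ^ 2)) * ch (snd p)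
      - 2 * a * A ^ 2 * (1 + m ^ 2) * ch (snd p) * sh (snd p) ^ 2)
      by (rewrite <- Ha, Hsh; ring).
    (* The hypothesis on [A] multiplied by [n^2], with [m * n = 1]: the form suited to the second
       coordinate. *)
    assert (Hn : 2 * a * A ^ 2 = n ^ 2 - 1).
    { transitivity ((m * n) ^ 2 * (2 * a * A ^ 2)); [rewrite Hmn; ring|].
      transitivity (n ^ 2 * (1 - m ^ 2)); [rewrite <- Ha; ring|].
      transitivity (n ^ 2 - (m * n) ^ 2); [ring | rewrite Hmn; ring]. }
    assert (Ha2 : (1 - n ^ 2) * sh (snd p) =
      2 * a * (A ^ 2 * (m ^ 2 * ch (snd p) ^ 2 + sh (snd p) ^ 2)) * sh (snd p)
      - 2 * a * A ^ 2 * (1 + m ^ 2) * ch (snd p) ^ 2 * sh (snd p)).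
    { transitivity (- (2 * a * A ^ 2) * sh (snd p)); [rewrite Hn; ring|].
      transitivity (2 * a * A ^ 2 * sh (snd p) * (sh (snd p) ^ 2 - ch (snd p) ^ 2));
        [rewrite Hsh|]; ring. }
    apply C2_ext; unfold torus_family; simpl.
    - transitivity (A * sin (m * fst p) * ((1 - m ^ 2) * ch (snd p))); [ring|].
      rewrite Ha1; ring.
    - transitivity (A * cos (m * fst p) * ((1 - m ^ 2) * ch (snd p))); [ring|].
      rewrite Ha1; ring.
    - transitivity (m * A * cos (n * fst p) * ((1 - n ^ 2) * sh (snd p))); [ring|].
      rewrite Ha2; ring.
    - transitivity (m * A * sin (n * fst p) * ((1 - n ^ 2) * sh (snd p))); [ring|].
      rewrite Ha2; ring. }
  rewrite Hlap, normal_part_add, !normal_part_scal, normal_part_D2 by assumption.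
  destruct (Hconf p) as [Hp _].
  destruct (normal_part _ _ _) as [[][]]; apply C2_ext; simpl; field; lra.
Qed.

(** * Planes and quotients of the plane *)

Lemma open_strip (f : R * R -> R) (c r : R) :
  (forall p, continuous f p) -> open (fun p => Rabs (f p - c) < r).
Proof.
  intros Hf; apply (open_comp f (fun x => Rabs (x - c) < r)); [intros; apply Hf|].
  intros x Hx.
  assert (Hr : 0 < r - Rabs (x - c)) by lra.
  exists (mkposreal _ Hr); intros y Hy.
  change (Rabs (y - x) < r - Rabs (x - c)) in Hy.
  replace (y - c) with ((y - x) + (x - c)) by ring.
  pose proof (Rabs_triang (y - x) (x - c)); lra.
Qed.

Lemma plane_hausdorff (p q : R * R) : p <> q ->
  exists O O' : R * R -> Prop, open O /\ open O' /\ O p /\ O' q /\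
    forall x, O x -> O' x -> False.
Proof.
  assert (Hsep : forall f : R * R -> R, (forall p, continuous f p) -> f p <> f q ->
    exists O O' : R * R -> Prop, open O /\ open O' /\ O p /\ O' q /\
    forall x, O x -> O' x -> False).
  { intros f Hf Hpq.
    exists (fun x => Rabs (f x - f p) < Rabs (f p - f q) / 2),
      (fun x => Rabs (f x - f q) < Rabs (f p - f q) / 2).
    assert (0 < Rabs (f p - f q)) by (apply Rabs_pos_lt; lra).
    split; [|split; [|split; [|split]]]; try (now apply open_strip);
      try (rewrite Rminus_diag, Rabs_R0; lra).
    intros x H1 H2.
    replace (f p - f q) with (- (f x - f p) + (f x - f q)) in * by ring.
    pose proof (Rabs_triang (- (f x - f p)) (f x - f q)).
    rewrite Rabs_Ropp in *; lra. }
  intros Hpq.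
  destruct (Req_dec (fst p) (fst q)) as [E1|E1];
    [destruct (Req_dec (snd p) (snd q)) as [E2|E2]|].
  - now destruct Hpq; apply injective_projections.
  - apply (Hsep snd); auto; intros []; apply continuous_snd.
  - apply (Hsep fst); auto; intros []; apply continuous_fst.
Qed.

Lemma smooth_R2_id (U : R * R -> Prop) : smooth_R2 U (fun p => p).
Proof.
  split; [replace (fun p : R * R => fst p) with (fun p : R * R => 1 * fst p + 0 * snd p + 0)
         |replace (fun p : R * R => snd p) with (fun p : R * R => 0 * fst p + 1 * snd p + 0)];
    try (apply smooth_affine; auto);
    apply functional_extensionality; intros; ring.
Qed.

Lemma plane_smooth_surface : smooth_surface plane_atlas.
Proof.
  split.
  - intros U x [-> _]; apply open_true.
  - intros U x [_ ->] p q _ _ E; exact E.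
  - exists (fun _ _ => True), (fun _ p => p); split.
    + intros _; split; reflexivity.
    + intros p; exists O, p; auto.
  - intros U x V y [-> ->] [-> ->] W; split.
    + apply (open_ext (fun _ => True)); [|apply open_true].
      intros p; split; auto; intros _; split; auto; exists p; auto.
    + exists (fun p => p); split; [apply smooth_R2_id | auto].
  - intros p q Hpq.
    destruct (plane_hausdorff Hpq) as (O & O' & HO & HO' & Op & Oq & Hd).
    exists (fun _ => True), (fun p => p), (fun _ => True), (fun p => p), p, q.
    repeat split; auto.
    exists O, O'; repeat split; auto.
    intros p' q' _ H1 _ H2 ->; eauto.
Qed.

(** A countable disjoint union of planes, the domain on which the sheets of a cone are
    parametrized. *)
Definition planes_atlas : atlas (nat * (R * R)) :=
  fun U x => U = (fun _ => True) /\ exists i, x = fun p => (i, p).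

Lemma planes_smooth_surface : smooth_surface planes_atlas.
Proof.
  split.
  - intros U x [-> _]; apply open_true.
  - intros U x [_ [i ->]] p q _ _ E; now injection E.
  - exists (fun _ _ => True), (fun i p => (i, p)); split.
    + intros i; split; [reflexivity | exists i; reflexivity].
    + intros [i p]; exists i, p; auto.
  - intros U x V y [-> [i ->]] [-> [j ->]] W.
    destruct (Nat.eq_dec i j) as [<-|Hij]; split.
    + apply (open_ext (fun _ => True)); [|apply open_true].
      intros p; split; auto; intros _; split; auto; exists p; auto.
    + exists (fun p => p); split; [apply smooth_R2_id | auto].
    (* Distinct sheets do not overlap, so the transition domain is empty and any map serves. *)
    + apply (open_ext (fun _ => False)); [|apply open_false].
      intros p; split; [easy|]; intros [_ [q [_ E]]]; injection E; congruence.
    + exists (fun p => p); split; [apply smooth_R2_id |].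
      intros p [_ [q [_ E]]]; injection E; congruence.
  - intros [i p] [j q] Hpq.
    destruct (Nat.eq_dec i j) as [<-|Hij].
    + assert (Hpq' : p <> q) by congruence.
      destruct (plane_hausdorff Hpq') as (O & O' & HO & HO' & Op & Oq & Hd).
      exists (fun _ => True), (fun p => (i, p)), (fun _ => True), (fun p => (i, p)), p, q.
      repeat split; eauto.
      exists O, O'; repeat split; auto.
      intros p' q' _ H1 _ H2 E; injection E as ->; eauto.
    + exists (fun _ => True), (fun p => (i, p)), (fun _ => True), (fun p => (j, p)), p, q.
      repeat split; eauto.
      exists (fun _ => True), (fun _ => True).
      repeat split; try apply open_true.
      intros p' q' _ _ _ _ E; injection E; congruence.
Qed.

(** All the properties are local, so the parameters may change from chart to chart, as they do on
    the sheets of a cone. *)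
Lemma torus_family_HSL_immersion (M : Type) (A : atlas M) (f : M -> C2) :
  smooth_surface A ->
  (forall U x, A U x -> exists m n A0 B ch sh,
     (fun p => f (x p)) = torus_family m n A0 B ch sh /\
     hyperbolic_pair ch sh /\ m * n = 1 /\ B ^ 2 = m ^ 2 * A0 ^ 2 /\ A0 <> 0 /\
     forall t, 0 < ch t) ->
  HSL_immersion A f.
Proof.
  intros HA Hf; split; [split; [exact HA|]|split]; intros U x HU;
    destruct (Hf U x HU) as (m & n & A0 & B & ch & sh & -> & H & Hmn & HB & H0 & Hch).
  - apply conformal_immersed; [now apply torus_family_smooth|].
    now apply torus_family_conformal.
  - now apply torus_family_lagrangian.
  - apply torus_family_hamiltonian_stationary; auto; exact (chart_open HA HU).
Qed.

(* [screw T e] is the translation of the cylinder for [e = 1] and the glide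
   reflection of the Moebius strip for [e = -1]. *)
Definition screw (T e : R) (x : R * R) : R * R := (fst x + T, e * snd x).

(** The [n]-th iterate of [screw T e], inverses included, when [e * e = 1]: the power of [e] depends
    only on the parity of [n]. *)
Definition screw_pow (T e : R) (n : Z) (x : R * R) : R * R :=
  (fst x + IZR n * T, (if Z.even n then 1 else e) * snd x).

Lemma screw_pow_add T e (He : e * e = 1) m n x :
  screw_pow T e m (screw_pow T e n x) = screw_pow T e (m + n) x.
Proof.
  unfold screw_pow; simpl; rewrite plus_IZR, Z.even_add.
  f_equal; [ring|].
  destruct (Z.even m), (Z.even n); simpl; try ring; rewrite <- Rmult_assoc, He; ring.
Qed.

Lemma screw_pow_0 T e x : screw_pow T e 0 x = x.
Proof. destruct x; unfold screw_pow; simpl; f_equal; ring. Qed.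

Lemma screw_pow_1 T e x : screw_pow T e 1 x = screw T e x.
Proof. unfold screw_pow, screw; simpl; f_equal; ring. Qed.

Lemma orbit_screw T e x y : e * e = 1 ->
  orbit (screw T e) x y <-> exists n, y = screw_pow T e n x.
Proof.
  intros He; split.
  - intros H; induction H as [x y ->|x|x y _ IH|x y z _ IH _ IH'].
    + exists 1%Z; now rewrite screw_pow_1.
    + exists 0%Z; now rewrite screw_pow_0.
    + destruct IH as [n ->]; exists (- n)%Z; rewrite screw_pow_add, Z.add_opp_diag_l by assumption.
      now rewrite screw_pow_0.
    + destruct IH as [n ->], IH' as [k ->]; exists (k + n)%Z; now rewrite screw_pow_add.
  - intros [n ->].
    (* Forward iterates are reached by induction; a negative power is the inverse of a forward one,
       and orbits are symmetric. *)
    assert (Hnat : forall (k : nat) x, orbit (screw T e) x (screw_pow T e (Z.of_nat k) x)).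
    { clear x n; intros k; induction k as [|k IH]; intros x.
      - rewrite screw_pow_0; apply rst_refl.
      - apply rst_trans with (screw_pow T e (Z.of_nat k) x); [apply IH|].
        apply rst_step; rewrite <- screw_pow_1, screw_pow_add by assumption.
        f_equal; lia. }
    destruct (Z.le_gt_cases 0 n) as [Hn|Hn].
    + rewrite <- (Z2Nat.id n Hn); apply Hnat.
    + apply rst_sym.
      replace x with (screw_pow T e (Z.of_nat (Z.to_nat (- n))) (screw_pow T e n x)) at 2.
      * apply Hnat.
      * rewrite screw_pow_add, Z2Nat.id by (assumption || lia).
        now rewrite Z.add_opp_diag_l, screw_pow_0.
Qed.

Lemma proj_eq g x y : proj g x = proj g y <-> orbit g x y.
Proof.
  split.
  - intros E; apply (f_equal (@proj1_sig _ _)) in E; simpl in E.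
    rewrite E; apply rst_refl.
  - intros H.
    assert (E : orbit g x = orbit g y).
    { apply functional_extensionality; intros z; apply propositional_extensionality.
      split; intros H'; [apply rst_trans with x; [apply rst_sym|] | apply rst_trans with y]; auto. }
    unfold proj; apply eq_sig_hprop; [intros; apply proof_irrelevance | exact E].
Qed.

Lemma proj_surj g (c : quotient g) : exists x, c = proj g x.
Proof.
  destruct c as [c [x ->]]; exists x; unfold proj.
  apply eq_sig_hprop; [intros; apply proof_irrelevance | reflexivity].
Qed.

(** The value is computed at a chosen representative; invariance along the generating relation makes
    it independent of the choice. *)
Lemma quotient_lift g (F : R * R -> C2) : (forall x, F (g x) = F x) ->
  exists f : quotient g -> C2, forall x, f (proj g x) = F x.
Proof.
  intros HF.
  exists (fun c => F (proj1_sig (constructive_indefinite_description _ (proj_surj c)))).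
  intros x; destruct (constructive_indefinite_description _ _) as [y Hy]; simpl.
  apply proj_eq in Hy; symmetry.
  induction Hy as [x y ->| | |]; congruence.
Qed.

(** The first coordinate moves by exactly [n * T]. This gives both the injectivity of the charts and
    the separation of orbits. *)
Lemma screw_pow_small T e n x y :
  0 < T -> Rabs (fst y - fst x) < T -> y = screw_pow T e n x -> n = 0%Z.
Proof.
  intros HT H ->; simpl in H.
  replace (fst x + IZR n * T - fst x) with (IZR n * T) in H by ring.
  rewrite Rabs_mult, (Rabs_right T) in H by lra.
  assert (H1 : Rabs (IZR n) < 1) by nra.
  rewrite <- abs_IZR in H1; apply lt_IZR in H1; lia.
Qed.

Lemma screw_chart T e c : 0 < T -> e * e = 1 ->
  quotient_atlas (screw T e) (fun p => Rabs (fst p - c) < T / 2) (proj (screw T e)).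
Proof.
  intros HT He; split; [|split; [reflexivity|]].
  - apply (open_strip (f := fst)); intros []; apply continuous_fst.
  - intros p q Hp Hq E; apply proj_eq, orbit_screw in E as [n E]; auto.
    assert (n = 0%Z) as ->.
    { apply (@screw_pow_small T e n p q); auto.
      replace (fst q - fst p) with ((fst q - c) + - (fst p - c)) by ring.
      eapply Rle_lt_trans; [apply Rabs_triang|]; rewrite Rabs_Ropp; lra. }
    now rewrite screw_pow_0 in E.
Qed.

Lemma screw_reduce T e c x : 0 < T ->
  exists n, Rabs (fst (screw_pow T e n x) - c) <= T / 2.
Proof.
  (* Adding [/ 2] before taking the integer part rounds to the nearest integer, hence the bound
     [T / 2]. *)
  intros HT; pose (r := (c - fst x) / T + / 2).
  exists (Int_part r); simpl.
  destruct (base_Int_part r) as [H1 H2].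
  replace (fst x + IZR (Int_part r) * T - c) with ((IZR (Int_part r) - r + / 2) * T)
    by (unfold r; field; lra).
  apply Rabs_le; nra.
Qed.

Lemma screw_pow_continuous T e n p : continuous (screw_pow T e n) p.
Proof.
  destruct p as [s t].
  apply (continuous_comp_2 (fun p => fst p + IZR n * T)
    (fun p => (if Z.even n then 1 else e) * snd p) pair).
  - apply (continuous_plus (V := R_NormedModule)); [apply continuous_fst | apply continuous_const].
  - apply (continuous_mult (K := R_AbsRing)); [apply continuous_const | apply continuous_snd].
  - apply (continuous_ext (fun p => p)); [now intros [] | apply continuous_id].
Qed.

Lemma smooth_R2_local (U : R * R -> Prop) tau :
  (forall p, U p -> exists h, smooth_R2 plane h /\ locally p (fun q => h q = tau q)) ->
  smooth_R2 U tau.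
Proof.
  intros H; split; intros k; apply Ck_local; intros p Hp;
    destruct (H p Hp) as (h & [Hh1 Hh2] & Hl).
  - exists (fun q => fst (h q)); split; [apply Hh1|].
    revert Hl; apply filter_imp; now intros q ->.
  - exists (fun q => snd (h q)); split; [apply Hh2|].
    revert Hl; apply filter_imp; now intros q ->.
Qed.

Lemma smooth_R2_screw_pow (U : R * R -> Prop) T e n : smooth_R2 U (screw_pow T e n).
Proof.
  split; unfold screw_pow; simpl.
  - replace (fun p : R * R => fst p + IZR n * T)
      with (fun p : R * R => 1 * fst p + 0 * snd p + IZR n * T);
      [apply smooth_affine; auto | apply functional_extensionality; intros; ring].
  - replace (fun p : R * R => (if Z.even n then 1 else e) * snd p)
      with (fun p : R * R => 0 * fst p + (if Z.even n then 1 else e) * snd p + 0);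
      [apply smooth_affine; auto | apply functional_extensionality; intros; ring].
Qed.

Lemma screw_smooth_surface T e : 0 < T -> e * e = 1 ->
  smooth_surface (quotient_atlas (screw T e)).
Proof.
  intros HT He; split.
  - intros U x [HU _]; exact HU.
  - intros U x (_ & -> & Hinj); exact Hinj.
  (* Two open strips of width [T] suffice, centred at 0 and at [T / 2]; every index other than 0
     repeats the second. *)
  - exists (fun i p => Rabs (fst p - match i with O => 0 | _ => T / 2 end) < T / 2),
      (fun _ => proj (screw T e)); split.
    + intros i; now apply screw_chart.
    + intros c; destruct (proj_surj c) as [x ->].
      destruct (screw_reduce e 0 x HT) as [n Hn].
      assert (Heq : forall k, proj (screw T e) (screw_pow T e k x) = proj (screw T e) x).
      { intros k; symmetry; apply proj_eq, orbit_screw; eauto. }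
      destruct Hn as [Hn|Hn].
      * exists O, (screw_pow T e n x); split; auto.
      * rewrite Rminus_0_r in Hn.
        (* On the boundary of the first strip, the point with [s = - T / 2] is moved by one more
           step to [T / 2], the centre of the second strip. *)
        unfold Rabs in Hn; destruct (Rcase_abs _) in Hn.
        -- exists 1%nat, (screw_pow T e (n + 1) x); split; auto.
           unfold screw_pow in *; simpl in *; rewrite plus_IZR.
           apply Rabs_def1; lra.
        -- exists 1%nat, (screw_pow T e n x); split; auto.
           rewrite Hn, Rminus_diag, Rabs_R0; lra.
  - intros U x V y (HU & -> & _) (HV & -> & HinjV) W.
    (* By continuity, the power that carries [p] into the open set [V] also carries a neighbourhood
       of [p] into it. *)
    assert (Hloc : forall p, W p -> exists n, locally p (fun p' => V (screw_pow T e n p'))).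
    { intros p [_ (q & Hq & E)]; symmetry in E.
      apply proj_eq, orbit_screw in E as [n ->]; auto.
      exists n; exact (screw_pow_continuous (HV _ Hq)). }
    assert (Heq : forall n p, proj (screw T e) (screw_pow T e n p) = proj (screw T e) p)
      by (intros n p; symmetry; apply proj_eq, orbit_screw; eauto).
    assert (HW : open W).
    { intros p Hp; destruct (Hloc p Hp) as [n Hn].
      generalize (filter_and _ _ (HU p (proj1 Hp)) Hn); apply filter_imp.
      intros p' [H1 H2]; split; eauto. }
    split; [exact HW|].
    assert (Htau : forall p, exists q, W p -> V q /\ proj (screw T e) q = proj (screw T e) p).
    { intros p; destruct (excluded_middle_informative (W p)) as [[Hp [q Hq]]|Hp];
        [exists q; auto | exists p; tauto]. }
    (* [tau] is chosen pointwise, but injectivity of the projection on [V] forces it to coincide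
       near [p] with one fixed power of the screw motion, which is smooth. *)
    destruct (choice _ Htau) as [tau Ht]; exists tau; split; [|exact Ht].
    apply smooth_R2_local; intros p Hp; destruct (Hloc p Hp) as [n Hn].
    exists (screw_pow T e n); split; [apply smooth_R2_screw_pow|].
    generalize (filter_and _ _ (HW p Hp) Hn); apply filter_imp.
    intros p' [H1 H2]; destruct (Ht p' H1) as [H3 H4].
    apply HinjV; auto; rewrite H4; apply Heq.
  - intros c c' Hc; destruct (proj_surj c) as [x ->], (proj_surj c') as [y ->].
    (* The second orbit is represented by a point [y'] within [T / 2] of [x] in the first
       coordinate. Between neighbourhoods of half-width [T / 4] a power then moves [s] by less than
       [T / 4 + T / 2 + T / 4 = T], so only the identity can relate them. *)
    destruct (screw_reduce e (fst x) y HT) as [n Hn].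
    set (y' := screw_pow T e n y) in *.
    assert (Ey : proj (screw T e) y' = proj (screw T e) y).
    { symmetry; apply proj_eq, orbit_screw; unfold y'; eauto. }
    rewrite <- Ey in Hc |- *.
    assert (Hxy : x <> y') by congruence.
    destruct (plane_hausdorff Hxy) as (O & O' & HO & HO' & Op & Oq & Hd).
    eexists _, _, _, _, x, y'.
    split; [exact (screw_chart (fst x) HT He)|].
    split; [exact (screw_chart (fst y') HT He)|].
    split; [rewrite Rminus_diag, Rabs_R0; lra|].
    split; [rewrite Rminus_diag, Rabs_R0; lra|].
    split; [reflexivity|]; split; [reflexivity|].
    assert (Hstrip : forall c, open (fun p : R * R => Rabs (fst p - c) < T / 4))
      by (intros; apply (open_strip (f := fst)); intros []; apply continuous_fst).
    exists (fun p => O p /\ Rabs (fst p - fst x) < T / 4),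
      (fun p => O' p /\ Rabs (fst p - fst y') < T / 4).
    split; [apply open_and; auto|]; split; [apply open_and; auto|].
    split; [split; auto; rewrite Rminus_diag, Rabs_R0; lra|].
    split; [split; auto; rewrite Rminus_diag, Rabs_R0; lra|].
    intros p q _ [H1 H2] _ [H3 H4] E; apply proj_eq, orbit_screw in E as [k E]; auto.
    assert (k = 0%Z) as ->.
    { apply (@screw_pow_small T e k p q); auto.
      replace (fst q - fst p)
        with ((fst q - fst y') + ((fst y' - fst x) + - (fst p - fst x))) by ring.
      eapply Rle_lt_trans; [apply Rabs_triang|].
      pose proof (Rabs_triang (fst y' - fst x) (- (fst p - fst x))).
      rewrite Rabs_Ropp in *; lra. }
    rewrite screw_pow_0 in E; subst q; eauto.
Qed.

(** * Self-intersections and the asymptotic cone *)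

Lemma cosh_pos t : 0 < cosh t.
Proof. unfold cosh; generalize (exp_pos t) (exp_pos (- t)); lra. Qed.

Lemma cosh2_minus_sinh2 t : cosh t ^ 2 - sinh t ^ 2 = 1.
Proof.
  unfold cosh, sinh.
  assert (H : exp t * exp (- t) = 1) by (rewrite <- exp_plus, Rplus_opp_r; apply exp_0).
  transitivity (exp t * exp (- t)); [field | exact H].
Qed.

Lemma sinh_inj x y : sinh x = sinh y -> x = y.
Proof. intros H; rewrite <- (arcsinh_sinh x), H; apply arcsinh_sinh. Qed.

Lemma sinh_opp t : sinh (- t) = - sinh t.
Proof. unfold sinh; rewrite Ropp_involutive; field. Qed.

Lemma cosh_opp t : cosh (- t) = cosh t.
Proof. unfold cosh; rewrite Ropp_involutive; field. Qed.

Lemma cosh_eq x y : cosh x = cosh y -> x = y \/ x = - y.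
Proof.
  intros H; generalize (cosh2_minus_sinh2 x) (cosh2_minus_sinh2 y); rewrite H; intros Hx Hy.
  assert (H0 : (sinh x - sinh y) * (sinh x + sinh y) = 0) by nra.
  apply Rmult_integral in H0 as [H0|H0]; [left|right]; apply sinh_inj; rewrite ?sinh_opp; lra.
Qed.

Lemma cos_sin_eq x y :
  (cos x = cos y /\ sin x = sin y) <-> exists k : Z, x = y + IZR k * (2 * PI).
Proof.
  split.
  - intros [Hc Hs].
    assert (H1 : cos (x - y) = 1)
      by (rewrite cos_minus, Hc, Hs; generalize (sin2_cos2 y); unfold Rsqr; lra).
    (* In terms of the half angle, [cos (x - y) = 1] says that [sin ((x - y) / 2)] vanishes. *)
    replace (x - y) with (2 * ((x - y) / 2)) in H1 by field.
    rewrite cos_2a_sin in H1.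
    assert (H2 : sin ((x - y) / 2) = 0) by nra.
    apply sin_eq_0_0 in H2 as [k Hk]; exists k; lra.
  - intros [k ->].
    assert (H0 : sin (IZR k * PI) = 0) by (apply sin_eq_0_1; eauto).
    replace (y + IZR k * (2 * PI)) with (y + 2 * (IZR k * PI)) by ring.
    rewrite cos_plus, sin_plus, cos_2a_sin, sin_2a, H0; lra.
Qed.

Lemma irrational_mult_IZR x (j k : Z) : irrational x -> x * IZR k = IZR j -> k = 0%Z.
Proof.
  intros Hx.
  assert (Hpos : forall (k : positive) j, x * IZR (Z.pos k) <> IZR j).
  { intros i l E; apply (Hx (Qmake l i)); unfold Q2R; simpl.
    assert (0 < IZR (Z.pos i)) by (apply IZR_lt; lia).
    rewrite <- E; field; lra. }
  intros E; destruct k as [|k|k]; [reflexivity| |].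
  - now destruct (Hpos k j).
  - destruct (Hpos k (- j)%Z); rewrite opp_IZR, <- E.
    change (Z.neg k) with (- Z.pos k)%Z; rewrite opp_IZR; ring.
Qed.

Lemma torus_family_embedded_off_waist m n A :
  m * n = 1 -> A <> 0 -> irrational (n ^ 2) ->
  embedded_off_waist (2 * PI * n) (torus_family m n A (m * A) cosh sinh).
Proof.
  intros Hmn HA Hirr s t s' t'; split.
  - intros E; unfold torus_family in E; simpl in E; injection E as E1 E2 E3 E4.
    assert (Hpi := PI_RGT_0).
    assert (Hm : m <> 0) by (intros ->; lra).
    assert (HmA : m * A <> 0) by (apply Rmult_integral_contrapositive; auto).
    rewrite !Rmult_assoc in E1, E2; apply Rmult_eq_reg_l in E1, E2; auto.
    rewrite !(Rmult_assoc (m * A)) in E3, E4; apply Rmult_eq_reg_l in E3, E4; auto.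
    assert (Hcosh : cosh t = cosh t').
    { assert (Hsq : cosh t * cosh t = cosh t' * cosh t').
      { transitivity ((cosh t * cos (m * s)) * (cosh t * cos (m * s)) +
                      (cosh t * sin (m * s)) * (cosh t * sin (m * s))).
        - ring [(trig_one (m * s))].
        - rewrite E1, E2; ring [(trig_one (m * s'))]. }
      generalize (cosh_pos t) (cosh_pos t'); nra. }
    rewrite Hcosh in E1, E2.
    assert (Hc' := cosh_pos t').
    apply Rmult_eq_reg_l in E1, E2; try lra.
    destruct (proj1 (cos_sin_eq (m * s) (m * s')) (conj E2 E1)) as [k Hk].
    assert (Hs : s = s' + IZR k * (2 * PI * n)).
    { transitivity (m * n * s); [rewrite Hmn; ring|].
      transitivity (n * (m * s)); [ring | rewrite Hk].
      transitivity (m * n * s' + IZR k * (2 * PI * n)); [ring | rewrite Hmn; ring]. }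
    destruct (Req_dec t' 0) as [->|Ht'].
    + right; split; [|split; auto].
      * destruct (cosh_eq Hcosh); lra.
      * exists (- k)%Z; rewrite opp_IZR; lra.
    + left.
      assert (Hsh : sinh t' <> 0) by (rewrite <- sinh_0; intros H; now apply sinh_inj in H).
      destruct (cosh_eq Hcosh) as [->| ->].
      * split; auto.
        apply Rmult_eq_reg_l in E3, E4; auto.
        destruct (proj1 (cos_sin_eq (n * s) (n * s')) (conj E3 E4)) as [j Hj].
        (* Substituting [s - s' = 2 * PI * n * k] in the phase equation of the second coordinate
           gives [n^2 * k = j]. *)
        assert (k = 0%Z) as ->; [|lra].
        apply (irrational_mult_IZR (j := j) Hirr).
        apply Rmult_eq_reg_r with (2 * PI); [|lra].
        rewrite Hs in Hj; lra.
      * exfalso.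
        rewrite sinh_opp, <- Ropp_mult_distr_l, Ropp_mult_distr_r in E3.
        rewrite sinh_opp, <- Ropp_mult_distr_l, Ropp_mult_distr_r in E4.
        apply Rmult_eq_reg_l in E3, E4; auto.
        (* The sign of [sinh] amounts to a half turn, so the phase equation becomes
           [n^2 * (2 * k) = 1 + 2 * j]. Irrationality makes the left side 0, while the right side is
           odd. *)
        assert (Hj : cos (n * s) = cos (n * s' + PI) /\ sin (n * s) = sin (n * s' + PI))
          by (rewrite neg_cos, neg_sin; lra).
        apply cos_sin_eq in Hj as [j Hj].
        assert (H0 : (2 * k)%Z = 0%Z).
        { apply (irrational_mult_IZR (j := (1 + 2 * j)%Z) Hirr).
          rewrite plus_IZR, !mult_IZR.
          apply Rmult_eq_reg_r with PI; [|lra].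
          rewrite Hs in Hj; lra. }
        assert (k = 0%Z) as -> by lia.
        apply (@eq_IZR_contrapositive (1 + 2 * j) 0); [lia|].
        rewrite plus_IZR, mult_IZR.
        apply Rmult_eq_reg_r with PI; [|lra].
        rewrite Hs in Hj; lra.
  - intros [[-> ->]|(-> & -> & k & ->)]; [reflexivity|].
    assert (Hk : exists k0 : Z, m * (s + IZR k * (2 * PI * n)) = m * s + IZR k0 * (2 * PI)).
    { exists k; transitivity (m * s + IZR k * (2 * PI * (m * n))); [ring | rewrite Hmn; ring]. }
    apply cos_sin_eq in Hk as [Hc Hs].
    unfold torus_family; simpl; rewrite Hc, Hs, sinh_0, !Rmult_0_r, !Rmult_0_l; reflexivity.
Qed.

(** For [Upsilon] the parameter [n] is negative, and so is the waist period [2 * PI * n] obtained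
    from it. *)
Lemma embedded_off_waist_opp L F : embedded_off_waist L F -> embedded_off_waist (- L) F.
Proof.
  intros H s t s' t'; rewrite (H s t s' t').
  split; (intros [Hl|(H1 & H2 & k & ->)]; [left; auto|]);
    right; repeat split; auto; exists (- k)%Z; rewrite opp_IZR; ring.
Qed.

(** * The asymptotic cone *)

Definition torus_cone (m n : R) (z : C2) : Prop :=
  exists x1 x2 s, x1 ^ 2 = n ^ 2 * x2 ^ 2 /\
    z = torus_family m n x1 x2 (fun _ => 1) (fun _ => 1) (s, 0).

(** Signs are encoded by parity, so that the two lowest bits of a sheet index hold the signs of both
    amplitudes. *)
Definition bit_sign (i : nat) : R := if Nat.even i then 1 else -1.

Lemma bit_sign_sqr i : bit_sign i ^ 2 = 1.
Proof. unfold bit_sign; destruct (Nat.even i); ring. Qed.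

Lemma sqr_eq_bit_sign x y : x ^ 2 = y ^ 2 -> exists i, (i < 2)%nat /\ x = bit_sign i * y.
Proof.
  intros H; assert (H0 : (x - y) * (x + y) = 0) by lra.
  apply Rmult_integral in H0 as [H0|H0];
    [exists O | exists 1%nat]; split; try lia; unfold bit_sign; simpl; lra.
Qed.

Lemma torus_cone_HSL m n : m * n = 1 -> HSL_cone (torus_cone m n).
Proof.
  intros Hmn; split.
  - intros r z Hr (x1 & x2 & s & Hx & ->).
    exists (r * x1), (r * x2), s; split.
    + transitivity (r ^ 2 * x1 ^ 2); [ring | rewrite Hx; ring].
    + apply C2_ext; simpl; ring.
  - (* One plane for each choice of the signs of [x1] and [x2]; the index runs over
       [nat], so each sheet is repeated. *)
    pose (f := fun z : nat * (R * R) =>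
      torus_family m n (bit_sign (fst z)) (bit_sign (Nat.div2 (fst z)) * m) exp exp (snd z)).
    assert (Hm : m <> 0) by (intros ->; lra).
    assert (Hs0 : forall i, bit_sign i <> 0)
      by (intros i; unfold bit_sign; destruct (Nat.even i); lra).
    exists (nat * (R * R))%type, planes_atlas, f; split.
    + apply torus_family_HSL_immersion; [apply planes_smooth_surface|].
      intros U x [-> [i ->]].
      exists m, n, (bit_sign i), (bit_sign (Nat.div2 i) * m), exp, exp.
      repeat split; auto using hyperbolic_pair_exp, exp_pos; try apply is_derive_exp.
      rewrite bit_sign_sqr, Rpow_mult_distr, bit_sign_sqr; ring.
    + intros z; split.
      * intros [(x1 & x2 & s & Hx & ->) Hz].
        assert (Hx2 : x2 ^ 2 = (m * x1) ^ 2).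
        { transitivity (m ^ 2 * x1 ^ 2); [|ring].
          rewrite Hx; transitivity ((m * n) ^ 2 * x2 ^ 2); [rewrite Hmn|]; ring. }
        assert (H1 : x1 <> 0).
        { intros ->; apply Hz.
          assert (x2 = 0) as -> by (apply Rsqr_0_uniq; unfold Rsqr; lra).
          apply C2_ext; simpl; ring. }
        assert (Ha : 0 < Rabs x1) by (now apply Rabs_pos_lt).
        destruct (@sqr_eq_bit_sign x1 (Rabs x1)) as (i & Hi & Ei);
          [now rewrite pow2_abs|].
        destruct (@sqr_eq_bit_sign x2 (m * Rabs x1)) as (j & Hj & Ej);
          [now rewrite Hx2, !Rpow_mult_distr, pow2_abs|].
        (* The index packs the two signs, and the logarithm makes [exp t] equal to [Rabs x1]. *)
        exists ((i + 2 * j)%nat, (s, ln (Rabs x1))).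
        unfold f, torus_family; simpl.
        replace (bit_sign (i + (j + (j + 0)))) with (bit_sign i)
          by (destruct i as [|[|]], j as [|[|]]; try lia; reflexivity).
        replace (bit_sign (Nat.div2 (i + (j + (j + 0))))) with (bit_sign j)
          by (destruct i as [|[|]], j as [|[|]]; try lia; reflexivity).
        rewrite exp_ln by assumption.
        apply C2_ext; simpl; (rewrite Ei at 2 || rewrite Ej at 1); ring.
      * intros [[i [s t]] <-]; split.
        -- exists (bit_sign i * exp t), (bit_sign (Nat.div2 i) * m * exp t), s; split.
           ++ rewrite !Rpow_mult_distr, !bit_sign_sqr.
              transitivity ((m * n) ^ 2 * exp t ^ 2); [rewrite Hmn|]; ring.
           ++ unfold f; apply C2_ext; simpl; ring.
        (* The first complex coordinate has modulus [exp t], so no sheet passes through the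
           vertex. *)
        -- intros E; unfold f, torus_family, zero2 in E; simpl in E; injection E as E1 E2 _ _.
           assert (H0 : bit_sign i * exp t <> 0).
           { apply Rmult_integral_contrapositive; split; auto.
             generalize (exp_pos t); lra. }
           apply Rmult_integral in E1 as [|E1]; [tauto|].
           apply Rmult_integral in E2 as [|E2]; [tauto|].
           generalize (sin2_cos2 (m * s)); rewrite E1, E2; unfold Rsqr; lra.
Qed.

Lemma cosh_minus_lead t : cosh t - cosh_lead t = exp (- Rabs t) / 2.
Proof.
  unfold cosh, cosh_lead, Rabs; destruct (Rcase_abs t); rewrite ?Ropp_involutive; field.
Qed.

Lemma sinh_minus_lead t : t <> 0 ->
  sinh t - sinh_lead t = - sign t * (exp (- Rabs t) / 2).
Proof.
  intros Ht; unfold sinh, sinh_lead.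
  destruct (Rlt_le_dec t 0) as [H|H].
  - rewrite (sign_eq_m1 t H), Rabs_left, Ropp_involutive by assumption; field.
  - rewrite sign_eq_1, Rabs_right by lra; field.
Qed.

Lemma sign_sqr t : t <> 0 -> sign t ^ 2 = 1.
Proof.
  intros Ht; destruct (Rlt_le_dec t 0) as [H|H].
  - rewrite (sign_eq_m1 t H); ring.
  - rewrite sign_eq_1 by lra; ring.
Qed.

Lemma torus_family_asymptotic m n A : m * n = 1 ->
  asymptotic_through (torus_family m n A (m * A) cosh sinh)
    (torus_family m n A (m * A) cosh_lead sinh_lead) (torus_cone m n).
Proof.
  intros Hmn; split.
  - intros s t Ht; exists (A * cosh_lead t), (m * A * sinh_lead t), s; split.
    + unfold cosh_lead, sinh_lead; rewrite !Rpow_mult_distr, sign_sqr by assumption.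
      transitivity ((m * n) ^ 2 * (A ^ 2 * (exp (Rabs t) / 2) ^ 2)); [rewrite Hmn|]; ring.
    + apply C2_ext; simpl; ring.
  - intros eps Heps.
    set (K := A ^ 2 * (1 + m ^ 2)).
    assert (HK : 0 <= K) by (unfold K; nra).
    (* The squared distance is [K * y^2 / 4] with [y = exp (- Rabs t)], whatever [s] is. Since
       [y * Rabs t < 1], this threshold yields [K * y < eps^2], and [y <= 1] does the rest. *)
    exists (K / eps ^ 2); intros s t Ht.
    assert (He2 : 0 < eps ^ 2) by nra.
    assert (HT : 0 <= K / eps ^ 2) by (apply Rdiv_le_0_compat; assumption).
    assert (Ht0 : t <> 0) by (intros ->; rewrite Rabs_R0 in Ht; lra).
    set (y := exp (- Rabs t)).
    assert (Hn : inner (sub2 (torus_family m n A (m * A) cosh sinh (s, t))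
                          (torus_family m n A (m * A) cosh_lead sinh_lead (s, t)))
                       (sub2 (torus_family m n A (m * A) cosh sinh (s, t))
                          (torus_family m n A (m * A) cosh_lead sinh_lead (s, t)))
                 = K * y ^ 2 / 4).
    { transitivity (A ^ 2 * (cosh t - cosh_lead t) ^ 2 +
                    (m * A) ^ 2 * (sinh t - sinh_lead t) ^ 2).
      - unfold inner; simpl; ring [(trig_one (m * s)) (trig_one (n * s))].
      - rewrite cosh_minus_lead, sinh_minus_lead by assumption; fold y.
        replace ((- sign t * (y / 2)) ^ 2) with (sign t ^ 2 * (y / 2) ^ 2) by ring.
        rewrite sign_sqr by assumption; unfold K; field. }
    unfold norm2; rewrite Hn.
    assert (Hy : 0 < y) by apply exp_pos.
    assert (Hy1 : y * Rabs t < 1).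
    { assert (Hexp : exp (Rabs t) * y = 1)
        by (unfold y; rewrite <- exp_plus, Rplus_opp_r; apply exp_0).
      assert (Rabs t < exp (Rabs t))
        by (generalize (exp_ineq1 (Rabs t) (Rabs_no_R0 t Ht0)); lra).
      nra. }
    assert (Hy2 : y <= 1).
    { unfold y; rewrite <- exp_0; left; apply exp_increasing;
      generalize (Rabs_pos_lt t Ht0); lra. }
    assert (HKt : K < eps ^ 2 * Rabs t).
    { apply Rmult_lt_compat_l with (r := eps ^ 2) in Ht; auto.
      replace (eps ^ 2 * (K / eps ^ 2)) with K in Ht by (field; lra); lra. }
    assert (HKy : K * y < eps ^ 2) by nra.
    rewrite <- (sqrt_pow2 eps) by lra.
    apply sqrt_lt_1_alt; nra.
Qed.

(** * The two families *)

(** The integers [j] and [k] count full turns of the two coordinates. For [e = -1] the additional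
    half turn of the second is undone by the oddness of [sinh], while [cosh] is even. *)
Lemma torus_family_screw m n A (T e : R) (j k : Z) :
  m * T = IZR j * (2 * PI) ->
  (e = 1 /\ n * T = IZR k * (2 * PI)) \/ (e = -1 /\ n * T = IZR k * (2 * PI) + PI) ->
  forall x, torus_family m n A (m * A) cosh sinh (screw T e x) =
            torus_family m n A (m * A) cosh sinh x.
Proof.
  intros Hm Hn [s t]; unfold torus_family, screw; simpl.
  assert (H1 : exists i : Z, m * (s + T) = m * s + IZR i * (2 * PI)) by (exists j; lra).
  apply cos_sin_eq in H1 as [-> ->].
  destruct Hn as [[-> Hn]|[-> Hn]].
  - assert (H2 : exists i : Z, n * (s + T) = n * s + IZR i * (2 * PI)) by (exists k; lra).
    apply cos_sin_eq in H2 as [-> ->]; now rewrite Rmult_1_l.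
  - assert (H2 : exists i : Z, n * (s + T) = n * s + PI + IZR i * (2 * PI))
      by (exists k; lra).
    apply cos_sin_eq in H2 as [-> ->].
    replace (-1 * t) with (- t) by ring.
    rewrite cosh_opp, sinh_opp, neg_cos, neg_sin; apply C2_ext; simpl; ring.
Qed.

Lemma torus_family_plane a m n A :
  m * n = 1 -> A <> 0 -> a <> 0 -> 2 * a * m ^ 2 * A ^ 2 = 1 - m ^ 2 ->
  let F := torus_family m n A (m * A) cosh sinh in
  HSL_immersion plane_atlas F /\ conformal F /\ self_similar_with a plane_atlas F.
Proof.
  intros Hmn HA Ha Heq F; split; [|split; [|split]].
  - apply torus_family_HSL_immersion; [apply plane_smooth_surface|].
    intros U x [-> ->]; exists m, n, A, (m * A), cosh, sinh.
    split; [reflexivity|]; split; [exact hyperbolic_pair_cosh_sinh|].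
    repeat split; auto using cosh_pos; ring.
  - apply torus_family_conformal; auto using hyperbolic_pair_cosh_sinh, cosh_pos; ring.
  - exact Ha.
  - intros U x [-> ->]; apply torus_family_similar;
      auto using hyperbolic_pair_cosh_sinh, cosh_pos, cosh2_minus_sinh2.
Qed.

(** Every chart of the quotient is a restriction of the projection, so in charts [f] is [F] itself
    and the local properties carry over. *)
Lemma torus_family_quotient a m n A T e :
  m * n = 1 -> A <> 0 -> a <> 0 -> 2 * a * m ^ 2 * A ^ 2 = 1 - m ^ 2 ->
  0 < T -> e * e = 1 ->
  let F := torus_family m n A (m * A) cosh sinh in
  (forall x, F (screw T e x) = F x) ->
  exists f : quotient (screw T e) -> C2,
    (forall x, f (proj (screw T e) x) = F x) /\
    HSL_immersion (quotient_atlas (screw T e)) f /\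
    self_similar_with a (quotient_atlas (screw T e)) f.
Proof.
  intros Hmn HA Ha Heq HT He F HF.
  destruct (quotient_lift HF) as [f Hf]; exists f; split; [exact Hf|].
  assert (E : (fun p => f (proj (screw T e) p)) = F)
    by (apply functional_extensionality; exact Hf).
  split; [|split].
  - apply torus_family_HSL_immersion; [now apply screw_smooth_surface|].
    intros U x (_ & -> & _); exists m, n, A, (m * A), cosh, sinh.
    split; [exact E|]; split; [exact hyperbolic_pair_cosh_sinh|].
    repeat split; auto using cosh_pos; ring.
  - exact Ha.
  - intros U x (_ & -> & _); rewrite E; apply torus_family_similar;
      auto using hyperbolic_pair_cosh_sinh, cosh_pos, cosh2_minus_sinh2.
Qed.

Lemma cylinder_map_screw p q :
  cylinder_map p q = screw (2 * PI * sqrt (INR p * INR q)) 1.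
Proof.
  apply functional_extensionality; intros x; unfold cylinder_map, screw; f_equal; ring.
Qed.

Lemma moebius_map_screw p q :
  moebius_map p q = screw (PI * sqrt (INR p * INR q)) (-1).
Proof.
  apply functional_extensionality; intros x; unfold moebius_map, screw; f_equal; ring.
Qed.

(* [sg] is the common sign of [m] and [n]: [1] for [Phi], [-1] for [Upsilon]. *)
Lemma torus_family_rational a m n A p q (sg : Z) :
  m * n = 1 -> A <> 0 -> a <> 0 -> 2 * a * m ^ 2 * A ^ 2 = 1 - m ^ 2 ->
  (0 < p)%nat -> (0 < q)%nat -> (sg = 1 \/ sg = -1)%Z ->
  n * sqrt (INR p * INR q) = IZR sg * INR p ->
  m * sqrt (INR p * INR q) = IZR sg * INR q ->
  let F := torus_family m n A (m * A) cosh sinh in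
  (forall s t, F (s + 2 * PI * sqrt (INR p * INR q), t) = F (s, t)) /\
  (exists f : quotient (cylinder_map p q) -> C2,
     (forall x, f (proj (cylinder_map p q) x) = F x) /\
     HSL_immersion (quotient_atlas (cylinder_map p q)) f /\
     self_similar_with a (quotient_atlas (cylinder_map p q)) f) /\
  (Nat.Odd p -> Nat.Even q ->
     (forall s t, F (s + PI * sqrt (INR p * INR q), - t) = F (s, t)) /\
     (exists f : quotient (moebius_map p q) -> C2,
        (forall x, f (proj (moebius_map p q) x) = F x) /\
        HSL_immersion (quotient_atlas (moebius_map p q)) f /\
        self_similar_with a (quotient_atlas (moebius_map p q)) f)).
Proof.
  intros Hmn HA Ha Heq Hp Hq Hsg Hn Hm F.
  assert (Hr : 0 < sqrt (INR p * INR q))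
    by (apply sqrt_lt_R0, Rmult_lt_0_compat; apply lt_0_INR; assumption).
  assert (Hpi := PI_RGT_0).
  assert (Hcyl : forall x, F (cylinder_map p q x) = F x).
  { rewrite cylinder_map_screw.
    apply (@torus_family_screw m n A _ _ (sg * Z.of_nat q) (sg * Z.of_nat p)).
    - rewrite mult_IZR, <- INR_IZR_INZ, <- Hm; ring.
    - left; split; auto; rewrite mult_IZR, <- INR_IZR_INZ, <- Hn; ring. }
  split; [intros s t; apply (Hcyl (s, t))|].
  split.
  - revert Hcyl; rewrite cylinder_map_screw; intros Hcyl.
    apply torus_family_quotient; auto; nra.
  - intros [p' Hp'] [q' Hq'].
    assert (Hmoe : forall x, F (moebius_map p q x) = F x).
    (* With [p = 2 * p' + 1] and [sg = 2 * sg' + 1], the second coordinate makes [sg * p' + sg']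
       full turns and a half; with [q = 2 * q'] the first makes [sg * q'] full turns. *)
    { assert (Hsg' : exists sg', sg = (2 * sg' + 1)%Z)
        by (destruct Hsg as [->| ->]; [exists 0%Z | exists (-1)%Z]; reflexivity).
      destruct Hsg' as [sg' Hsg'].
      rewrite moebius_map_screw.
      apply (@torus_family_screw m n A _ _ (sg * Z.of_nat q')
               (sg * Z.of_nat p' + sg')).
      - transitivity (PI * (m * sqrt (INR p * INR q))); [ring|].
        rewrite Hm, Hq', mult_INR, mult_IZR, <- INR_IZR_INZ; simpl; ring.
      - right; split; auto.
        transitivity (PI * (n * sqrt (INR p * INR q))); [ring|].
        rewrite Hn, Hp', plus_INR, mult_INR, plus_IZR, mult_IZR, <- INR_IZR_INZ.
        rewrite Hsg', plus_IZR, mult_IZR; simpl; ring. }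
    split; [intros s t; apply (Hmoe (s, t))|].
    revert Hmoe; rewrite moebius_map_screw; intros Hmoe.
    apply torus_family_quotient; auto; nra.
Qed.

(** * Both families and their cones in terms of the torus family *)

Lemma Phi_gen_torus a delta ch sh :
  Phi_gen a delta ch sh =
  torus_family (/ cosh delta) (cosh delta) (/ sqrt (2 * a) * sinh delta)
    (/ cosh delta * (/ sqrt (2 * a) * sinh delta)) ch sh.
Proof.
  apply functional_extensionality; intros [s t]; unfold Phi_gen, torus_family, tanh, Rdiv;
  cbn [fst snd].
  rewrite (Rmult_comm s (/ cosh delta)).
  unfold expi; rewrite cos_neg, sin_neg; apply C2_ext; simpl; ring.
Qed.

(** The conjugated phases make [m] and [n] negative and the factor [- i] makes the first amplitude
    the opposite of its positive counterpart; the two signs cancel in the second amplitude. *)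
Lemma Upsilon_gen_torus a gamma ch sh :
  Upsilon_gen a gamma ch sh =
  torus_family (- / cos gamma) (- cos gamma) (- (/ sqrt (- 2 * a) * sin gamma))
    (- / cos gamma * - (/ sqrt (- 2 * a) * sin gamma)) ch sh.
Proof.
  apply functional_extensionality; intros [s t]; unfold Upsilon_gen, torus_family, tan, Rdiv;
  cbn [fst snd].
  rewrite (Rmult_comm s (/ cos gamma)), <- !Ropp_mult_distr_l.
  unfold expi; rewrite !cos_neg, !sin_neg; apply C2_ext; simpl; ring.
Qed.

Lemma Phi_cone_torus delta : Phi_cone delta = torus_cone (/ cosh delta) (cosh delta).
Proof.
  apply functional_extensionality; intros z; apply propositional_extensionality.
  split; intros (x1 & x2 & s & Hx & ->); exists x1, x2, s; (split; [exact Hx|]);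
    unfold torus_family, Rdiv, expi; cbn [fst snd];
    rewrite (Rmult_comm s (/ cosh delta)), cos_neg, sin_neg;
    apply C2_ext; simpl; ring.
Qed.

Lemma Upsilon_cone_torus gamma :
  Upsilon_cone gamma = torus_cone (- / cos gamma) (- cos gamma).
Proof.
  apply functional_extensionality; intros z; apply propositional_extensionality.
  (* Replacing [x1] by [- x1] turns the factor [- i] into [i], and preserves the quadratic
     equation. *)
  split; intros (x1 & x2 & s & Hx & ->); exists (- x1), x2, s;
    (split; [ring_simplify; ring_simplify in Hx; exact Hx|]);
    unfold torus_family, Rdiv, expi; cbn [fst snd];
    rewrite (Rmult_comm s (/ cos gamma)), <- !Ropp_mult_distr_l, !cos_neg, !sin_neg;
    apply C2_ext; simpl; ring.
Qed.

Lemma Phi_pq_torus a p q m n A :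
  m = sqrt (INR q / INR p) -> n = sqrt (INR p / INR q) ->
  A = sqrt ((INR p - INR q) / (2 * a)) / sqrt (INR q) ->
  m * A = sqrt ((INR p - INR q) / (2 * a)) / sqrt (INR p) ->
  Phi_pq a p q = torus_family m n A (m * A) cosh sinh.
Proof.
  intros Hm Hn HA HB; rewrite HB, HA, Hm, Hn.
  apply functional_extensionality; intros [s t]; unfold Phi_pq, torus_family, Rdiv, expi.
  rewrite cos_neg, sin_neg; apply C2_ext; simpl; ring.
Qed.

Lemma Upsilon_pq_torus a p q m n A :
  m = - sqrt (INR q / INR p) -> n = - sqrt (INR p / INR q) ->
  A = - (sqrt ((INR q - INR p) / (- 2 * a)) / sqrt (INR q)) ->
  m * A = sqrt ((INR q - INR p) / (- 2 * a)) / sqrt (INR p) ->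
  Upsilon_pq a p q = torus_family m n A (m * A) cosh sinh.
Proof.
  intros Hm Hn HA HB; rewrite HB, HA, Hm, Hn.
  apply functional_extensionality; intros [s t]; unfold Upsilon_pq, torus_family, Rdiv, expi.
  rewrite <- !Ropp_mult_distr_l, !cos_neg, !sin_neg; apply C2_ext; simpl; ring.
Qed.

Lemma sqrt_unique_pos x y : 0 <= y -> y ^ 2 = x -> sqrt x = y.
Proof. intros Hy <-; now apply sqrt_pow2. Qed.

Lemma sqrt_ratio_mult x y : 0 < x -> 0 < y -> sqrt (x / y) * sqrt (x * y) = x.
Proof.
  intros Hx Hy.
  rewrite <- sqrt_mult by (try apply Rdiv_le_0_compat; nra).
  apply sqrt_unique_pos; [lra | field; lra].
Qed.

Lemma sqrt_ratio_inv x y : 0 < x -> 0 < y -> / sqrt (x / y) = sqrt (y / x).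
Proof.
  intros Hx Hy; rewrite <- sqrt_inv; f_equal; field; lra.
Qed.

Lemma sinh_pos x : 0 < x -> 0 < sinh x.
Proof. intros Hx; rewrite <- sinh_0; now apply sinh_lt. Qed.

Theorem proposition2 :
  (forall a delta : R, 0 < a -> 0 < delta ->
     (HSL_immersion plane_atlas (Phi a delta) /\
      conformal (Phi a delta) /\
      self_similar_with a plane_atlas (Phi a delta)) /\
     (irrational (cosh delta ^ 2) ->
        embedded_off_waist (2 * PI * cosh delta) (Phi a delta) /\
        self_expander plane_atlas (Phi a delta) /\
        HSL_cone (Phi_cone delta) /\
        asymptotic_through (Phi a delta) (Phi_lead a delta) (Phi_cone delta)) /\
     (forall p q : nat, (0 < q)%nat -> (q < p)%nat -> Nat.gcd p q = 1%nat ->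
        cosh delta ^ 2 = INR p / INR q ->
        (forall s t, Phi a delta (s, t) = Phi_pq a p q (s, t)) /\
        (forall s t,
           Phi_pq a p q (s + 2 * PI * sqrt (INR p * INR q), t) =
           Phi_pq a p q (s, t)) /\
        (exists f : quotient (cylinder_map p q) -> C2,
           (forall x, f (proj (cylinder_map p q) x) = Phi_pq a p q x) /\
           HSL_immersion (quotient_atlas (cylinder_map p q)) f /\
           self_expander (quotient_atlas (cylinder_map p q)) f) /\
        (Nat.Odd p -> Nat.Even q ->
           (forall s t,
              Phi_pq a p q (s + PI * sqrt (INR p * INR q), - t) =
              Phi_pq a p q (s, t)) /\
           (exists f : quotient (moebius_map p q) -> C2,
              (forall x, f (proj (moebius_map p q) x) = Phi_pq a p q x) /\
              HSL_immersion (quotient_atlas (moebius_map p q)) f /\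
              self_expander (quotient_atlas (moebius_map p q)) f)))) /\
  (forall a gamma : R, a < 0 -> 0 < gamma -> gamma < PI / 2 ->
     (HSL_immersion plane_atlas (Upsilon a gamma) /\
      conformal (Upsilon a gamma) /\
      self_similar_with a plane_atlas (Upsilon a gamma)) /\
     (irrational (cos gamma ^ 2) ->
        embedded_off_waist (2 * PI * cos gamma) (Upsilon a gamma) /\
        self_shrinker plane_atlas (Upsilon a gamma) /\
        HSL_cone (Upsilon_cone gamma) /\
        asymptotic_through (Upsilon a gamma) (Upsilon_lead a gamma)
          (Upsilon_cone gamma)) /\
     (forall p q : nat, (0 < p)%nat -> (p < q)%nat -> Nat.gcd p q = 1%nat ->
        cos gamma ^ 2 = INR p / INR q ->
        (forall s t, Upsilon a gamma (s, t) = Upsilon_pq a p q (s, t)) /\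
        (forall s t,
           Upsilon_pq a p q (s + 2 * PI * sqrt (INR p * INR q), t) =
           Upsilon_pq a p q (s, t)) /\
        (exists f : quotient (cylinder_map p q) -> C2,
           (forall x, f (proj (cylinder_map p q) x) = Upsilon_pq a p q x) /\
           HSL_immersion (quotient_atlas (cylinder_map p q)) f /\
           self_shrinker (quotient_atlas (cylinder_map p q)) f) /\
        (Nat.Odd p -> Nat.Even q ->
           (forall s t,
              Upsilon_pq a p q (s + PI * sqrt (INR p * INR q), - t) =
              Upsilon_pq a p q (s, t)) /\
           (exists f : quotient (moebius_map p q) -> C2,
              (forall x, f (proj (moebius_map p q) x) = Upsilon_pq a p q x) /\
              HSL_immersion (quotient_atlas (moebius_map p q)) f /\
              self_shrinker (quotient_atlas (moebius_map p q)) f)))).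
Proof.
  split; [intros a delta Ha Hdelta | intros a gamma Ha Hg0 Hg1].
  { assert (Hcosh := cosh_pos delta); assert (Hsinh := sinh_pos Hdelta).
    assert (H2a : 0 < sqrt (2 * a)) by (apply sqrt_lt_R0; lra).
    unfold Phi, Phi_lead; rewrite !Phi_gen_torus, Phi_cone_torus.
    set (m := / cosh delta); set (n := cosh delta).
    set (A := / sqrt (2 * a) * sinh delta).
    assert (Hmn : m * n = 1) by (unfold m, n; field; lra).
    assert (HA : 0 < A) by (apply Rmult_lt_0_compat; [now apply Rinv_0_lt_compat | assumption]).
    (* Both sides equal [sinh delta ^ 2]. *)
    assert (HA2 : 2 * a * A ^ 2 = n ^ 2 - 1).
    { unfold A, n; rewrite Rpow_mult_distr, pow_inv, pow2_sqrt by lra.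
      transitivity (sinh delta ^ 2); [field; lra|].
      generalize (cosh2_minus_sinh2 delta); lra. }
    assert (Heq : 2 * a * m ^ 2 * A ^ 2 = 1 - m ^ 2).
    { transitivity (m ^ 2 * (2 * a * A ^ 2)); [ring|].
      rewrite HA2; transitivity ((m * n) ^ 2 - m ^ 2); [ring | rewrite Hmn; ring]. }
    assert (HA0 : A <> 0) by lra; assert (Ha0 : a <> 0) by lra.
    assert (Hplane := torus_family_plane Hmn HA0 Ha0 Heq).
    split; [exact Hplane|]; split.
    - intros Hirr; split; [|split; [|split]].
      + now apply torus_family_embedded_off_waist.
      + exists a; split; [exact Ha | apply Hplane].
      + now apply torus_cone_HSL.
      + now apply torus_family_asymptotic.
    - intros p q Hq Hqp _ Hpq.
      assert (HQ : 0 < INR q) by (now apply lt_0_INR).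
      assert (HPQ : INR q < INR p) by (now apply lt_INR).
      assert (HP : 0 < INR p) by lra.
      assert (Hn : n = sqrt (INR p / INR q))
        by (symmetry; apply sqrt_unique_pos; [unfold n; lra | exact Hpq]).
      assert (Hm : m = sqrt (INR q / INR p))
        by (rewrite <- sqrt_ratio_inv, <- Hn by assumption; reflexivity).
      (* [A] is the positive root of [A^2 = (n^2 - 1) / (2 * a)], where [n^2 = p / q]. *)
      assert (HAq : A = sqrt ((INR p - INR q) / (2 * a)) / sqrt (INR q)).
      { rewrite <- sqrt_div_alt by assumption.
        symmetry; apply sqrt_unique_pos; [lra|].
        transitivity ((2 * a * A ^ 2) / (2 * a)); [field; lra|].
        rewrite HA2, Hpq; field; lra. }
      assert (HAp : m * A = sqrt ((INR p - INR q) / (2 * a)) / sqrt (INR p)).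
      { rewrite HAq, Hm, sqrt_div_alt by assumption; field.
        split; apply Rgt_not_eq, sqrt_lt_R0; assumption. }
      rewrite (Phi_pq_torus Hm Hn HAq HAp).
      split; [reflexivity|].
      assert (Hnr : n * sqrt (INR p * INR q) = IZR 1 * INR p)
        by (rewrite Hn, sqrt_ratio_mult by assumption; ring).
      assert (Hmr : m * sqrt (INR p * INR q) = IZR 1 * INR q)
        by (rewrite Hm, (Rmult_comm (INR p)), sqrt_ratio_mult by assumption; ring).
      assert (Hp0 : (0 < p)%nat) by lia.
      destruct (torus_family_rational Hmn HA0 Ha0 Heq Hp0 Hq (or_introl eq_refl) Hnr Hmr)
        as (H1 & (f & Hf1 & Hf2 & Hf3) & H3).
      split; [exact H1|]; split.
      + exists f; repeat split; try apply Hf2; auto; exists a; auto.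
      + intros Hodd Heven; destruct (H3 Hodd Heven) as [H4 (f' & Hf1' & Hf2' & Hf3')].
        split; [exact H4|].
        exists f'; split; [exact Hf1'|]; split; [exact Hf2'|]; exists a; auto. }
  { assert (Hcos : 0 < cos gamma) by (apply cos_gt_0; lra).
    assert (Hsin : 0 < sin gamma) by (apply sin_gt_0; lra).
    assert (H2a : 0 < sqrt (- 2 * a)) by (apply sqrt_lt_R0; lra).
    unfold Upsilon, Upsilon_lead; rewrite !Upsilon_gen_torus, Upsilon_cone_torus.
    set (m := - / cos gamma); set (n := - cos gamma).
    set (A := - (/ sqrt (- 2 * a) * sin gamma)).
    assert (Hmn : m * n = 1) by (unfold m, n; field; lra).
    assert (HA : A < 0).
    { unfold A; apply Ropp_lt_gt_0_contravar, Rmult_lt_0_compat;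
        [now apply Rinv_0_lt_compat | assumption]. }
    (* Here [a] is negative and both sides equal minus the square of [sin gamma]. *)
    assert (HA2 : 2 * a * A ^ 2 = n ^ 2 - 1).
    { unfold A, n.
      replace ((- (/ sqrt (- 2 * a) * sin gamma)) ^ 2)
        with ((/ sqrt (- 2 * a)) ^ 2 * sin gamma ^ 2) by ring.
      rewrite pow_inv, pow2_sqrt by lra.
      transitivity (- (sin gamma * sin gamma)); [field; lra|].
      rewrite trig_one; ring. }
    assert (Heq : 2 * a * m ^ 2 * A ^ 2 = 1 - m ^ 2).
    { transitivity (m ^ 2 * (2 * a * A ^ 2)); [ring|].
      rewrite HA2; transitivity ((m * n) ^ 2 - m ^ 2); [ring | rewrite Hmn; ring]. }
    assert (HA0 : A <> 0) by lra; assert (Ha0 : a <> 0) by lra.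
    assert (Hplane := torus_family_plane Hmn HA0 Ha0 Heq).
    assert (Hn2 : n ^ 2 = cos gamma ^ 2) by (unfold n; ring).
    split; [exact Hplane|]; split.
    - intros Hirr; split; [|split; [|split]].
      + replace (2 * PI * cos gamma) with (- (2 * PI * n)) by (unfold n; ring).
        apply embedded_off_waist_opp, torus_family_embedded_off_waist; auto.
        now rewrite Hn2.
      + exists a; split; [exact Ha | apply Hplane].
      + now apply torus_cone_HSL.
      + now apply torus_family_asymptotic.
    - intros p q Hp Hpq' _ Hpq.
      assert (HP : 0 < INR p) by (now apply lt_0_INR).
      assert (HPQ : INR p < INR q) by (now apply lt_INR).
      assert (HQ : 0 < INR q) by lra.
      assert (Hc : cos gamma = sqrt (INR p / INR q))
        by (symmetry; apply sqrt_unique_pos; [lra | exact Hpq]).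
      assert (Hn : n = - sqrt (INR p / INR q)) by (unfold n; now rewrite Hc).
      assert (Hm : m = - sqrt (INR q / INR p))
        by (unfold m; now rewrite Hc, sqrt_ratio_inv).
      assert (HAq : A = - (sqrt ((INR q - INR p) / (- 2 * a)) / sqrt (INR q))).
      { rewrite <- sqrt_div_alt by assumption.
        (* [A] is negative, so the nonnegative root is [- A]. *)
        rewrite (@sqrt_unique_pos _ (- A)); [ring | lra |].
        transitivity ((2 * a * A ^ 2) / (2 * a)); [field; lra|].
        rewrite HA2, Hn2, Hpq; field; lra. }
      assert (HAp : m * A = sqrt ((INR q - INR p) / (- 2 * a)) / sqrt (INR p)).
      { rewrite HAq, Hm, sqrt_div_alt by assumption; field.
        split; apply Rgt_not_eq, sqrt_lt_R0; assumption. }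
      rewrite (Upsilon_pq_torus Hm Hn HAq HAp).
      split; [reflexivity|].
      assert (Hnr : n * sqrt (INR p * INR q) = IZR (-1) * INR p)
        by (rewrite Hn, <- Ropp_mult_distr_l, sqrt_ratio_mult by assumption; ring).
      assert (Hmr : m * sqrt (INR p * INR q) = IZR (-1) * INR q)
        by (rewrite Hm, (Rmult_comm (INR p)), <- Ropp_mult_distr_l, sqrt_ratio_mult
              by assumption; ring).
      assert (Hq0 : (0 < q)%nat) by lia.
      destruct (torus_family_rational Hmn HA0 Ha0 Heq Hp Hq0 (or_intror eq_refl) Hnr Hmr)
        as (H1 & (f & Hf1 & Hf2 & Hf3) & H3).
      split; [exact H1|]; split.
      + exists f; split; [exact Hf1|]; split; [exact Hf2|]; exists a; auto.
      + intros Hodd Heven; destruct (H3 Hodd Heven) as [H4 (f' & Hf1' & Hf2' & Hf3')].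
        split; [exact H4|].
        exists f'; split; [exact Hf1'|]; split; [exact Hf2'|]; exists a; auto. }
Qed.
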